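(* Let $\Omega\subset\mathbb{R}^n$ be a bounded open set, let $s\in(0,1)$, let $\mu>0$, and let $G$ be a Young function such that $1<p^-\le \frac{t g(t)}{G(t)}\le p^+<\infty$ for all $t>0$. Let $\{\rho_\varepsilon\}_{\varepsilon>0}$ be a family of functions satisfying $0<\rho_-\le\rho_\varepsilon(x)\le\rho_+<\infty$ for all $x\in\mathbb{R}^n$, with constants $\rho_\pm$, such that $\rho_\varepsilon\rightharpoonup\rho_0$ weakly* in $L^\infty(\Omega)$ as $\varepsilon\to0$. Then $$\lim_{\varepsilon\to0}\alpha_{1,\mu}(\rho_\varepsilon)=\alpha_{1,\mu}(\rho_0).$$
   Context: A Young function is a function $G:[0,\infty)\to[0,\infty)$ of the form $G(t)=\int_0^t g(\tau)\,d\tau$, where $g:[0,\infty)\to[0,\infty)$ is right continuous and nondecreasing, $g(0)=0$, $g(t)>0$ for $t>0$, and $\lim_{t\to\infty}g(t)=\infty$. Put $D_su(x,y)=\frac{u(x)-u(y)}{|x-y|^s}$. For an open set $U\subseteq\mathbb{R}^n$, $W^{s,G}(U)$ is the set of measurable $u:\mathbb{R}^n\to\mathbb{R}$ with $\int_U G(|u|)\,dx<\infty$ and $\iint_{\mathbb{R}^n\times\mathbb{R}^n}G(|D_su|)\frac{dx\,dy}{|x-y|^n}<\infty$, and $W^{s,G}_0(\Omega)=\{u\in W^{s,G}(\mathbb{R}^n):u=0\text{ a.e. in }\mathbb{R}^n\setminus\Omega\}$. For a weight $\rho$, $$\alpha_{1,\mu}(\rho)=\inf_{u\in M_\mu}\frac{\iint_{\mathbb{R}^n\times\mathbb{R}^n}G(|D_su|)\frac{dx\,dy}{|x-y|^n}}{\int_\Omega\rho\,G(|u|)\,dx},\qquad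 M_\mu=\Big\{u\in W^{s,G}_0(\Omega):\int_\Omega G(|u|)\,dx=\mu\Big\}.$$ *)

(* Defs.v *)
From HB Require Import structures.
From mathcomp Require Import all_boot all_order all_algebra.
From mathcomp Require Import all_classical all_reals all_analysis.
From mathcomp Require Import measurable_realfun.

Set Implicit Arguments.
Unset Strict Implicit.
Unset Printing Implicit Defensive.
Import Order.TTheory GRing.Theory Num.Theory.
Import numFieldNormedType.Exports.

Local Open Scope classical_set_scope.
Local Open Scope ring_scope.

(* R^n is 'rV[R]_n.  It has a topology and a norm in the library, but no
   sigma-algebra and no measure; it is given here the sigma-algebra generated
   by the coordinates, i.e. the Borel sigma-algebra, as the library does for
   n.-tuple R. *)
Section measurable_rV.
Context {R : realType} {n : nat}.

Let coors : 'I_n -> 'rV[R]_n -> R := fun i x => x ord0 i.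

Let rV_set0 : g_sigma_preimage coors set0.
Proof. exact: sigma_algebra0. Qed.

Let rV_setC A : g_sigma_preimage coors A -> g_sigma_preimage coors (~` A).
Proof. exact: sigma_algebraC. Qed.

Let rV_bigcup (F : (set 'rV[R]_n)^nat) :
  (forall i, g_sigma_preimage coors (F i)) ->
  g_sigma_preimage coors (\bigcup_i (F i)).
Proof. exact: sigma_algebra_bigcup. Qed.

HB.instance Definition _ := @isMeasurable.Build default_measure_display
  'rV[R]_n (g_sigma_preimage coors) rV_set0 rV_setC rV_bigcup.

Lemma measurable_coord (i : 'I_n) :
  measurable_fun [set: 'rV[R]_n] (fun x => x ord0 i).
Proof.
move=> _ Y mY; rewrite setTI; apply: sub_sigma_algebra => /=.
rewrite -bigcup_seq/=; exists i => /=; first by rewrite mem_index_enum.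
by exists Y => //; rewrite setTI.
Qed.

Lemma measurable_fun_rVP d (T : measurableType d) (f : T -> 'rV[R]_n) :
  (forall i, measurable_fun [set: T] (fun t => f t ord0 i)) ->
  measurable_fun [set: T] f.
Proof.
move=> mf; apply: (@measurability _ _ _ _ setT f
  (\big[setU/set0]_(i < n) preimage_set_system setT (coors i) measurable)) => //.
move=> _ [A + <-]; rewrite -bigcup_seq => -[i _ [B mB <-]].
by rewrite !setTI; have := mf i measurableT B mB; rewrite setTI.
Qed.

End measurable_rV.

Lemma sigma_finite_prod d1 d2 (T1 : measurableType d1) (T2 : measurableType d2)
    (R : realType) (m1 : {sigma_finite_measure set T1 -> \bar R})
    (m2 : {sigma_finite_measure set T2 -> \bar R}) :
  sigma_finite setT (m1 \x m2)%E.
Proof.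
have /sigma_finiteP[F [TF ndF Foo]] := sigma_finiteT m1.
have /sigma_finiteP[G [TG ndG Goo]] := sigma_finiteT m2.
exists (fun k => F k `*` G k).
  rewrite -setXTT TF TG predeqE => -[x y]; split.
    move=> [/= [i _ Fix] [j _ Gjy]]; exists (maxn i j) => //; split.
    - by move: x Fix; exact/subsetPset/ndF/leq_maxl.
    - by move: y Gjy; exact/subsetPset/ndG/leq_maxr.
  by move=> [i _ []/= ? ?]; split; exists i.
move=> k; have [? ?] := Foo k; have [? ?] := Goo k.
split; first exact: measurableX.
by rewrite product_measure1E// lte_mul_pinfty// ge0_fin_numE.
Qed.

Section lebesgue_measure_rV.
Context {R : realType}.

Definition rV_cons n (p : R * 'rV[R]_n) : 'rV[R]_n.+1 :=
  \row_i oapp (p.2 ord0) p.1 (unlift ord0 i).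

Definition rV_uncons n (x : 'rV[R]_n.+1) : R * 'rV[R]_n :=
  (x ord0 ord0, \row_i x ord0 (lift ord0 i)).

Lemma rV_consK n : cancel (@rV_cons n) (@rV_uncons n).
Proof.
move=> [a x]; rewrite /rV_uncons /rV_cons; congr pair.
  by rewrite mxE unlift_none.
by apply/rowP => i; rewrite !mxE liftK.
Qed.

Lemma measurable_rV_cons n : measurable_fun setT (@rV_cons n).
Proof.
apply: measurable_fun_rVP => i.
have [j ->|->] := unliftP ord0 i.
  rewrite (_ : (fun _ => _) = (fun x : 'rV[R]_n => x ord0 j) \o snd).
    by apply: measurableT_comp => //; exact: measurable_coord.
  by apply/funext => p /=; rewrite mxE liftK.
rewrite (_ : (fun _ => _) = fst) //.
by apply/funext => p /=; rewrite mxE unlift_none.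
Qed.

Lemma measurable_rV_uncons n : measurable_fun setT (@rV_uncons n).
Proof.
apply/measurable_fun_pairP; split => /=; first exact: measurable_coord.
apply: measurable_fun_rVP => i /=.
rewrite (_ : (fun _ => _) = fun x : 'rV[R]_n.+1 => x ord0 (lift ord0 i)).
  exact: measurable_coord.
by apply/funext => x /=; rewrite mxE.
Qed.

Section cons_measure.
Context {n : nat} (mu : {sigma_finite_measure set 'rV[R]_n -> \bar R}).

Definition cons_measure : set 'rV[R]_n.+1 -> \bar R :=
  pushforward (@lebesgue_measure R \x mu)%E (@rV_cons n).

Let cons_measure0 : (cons_measure set0 = 0)%E.
Proof. by rewrite /cons_measure /pushforward preimage_set0 measure0. Qed.

Let cons_measure_ge0 A : (0 <= cons_measure A)%E.
Proof. by rewrite /cons_measure /pushforward measure_ge0. Qed.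

Let cons_measure_sigma_additive : semi_sigma_additive cons_measure.
Proof.
have mcons A : measurable A -> measurable (@rV_cons n @^-1` A).
  by move=> mA; rewrite -[X in measurable X]setTI; exact: measurable_rV_cons.
move=> F mF tF mUF; rewrite /cons_measure /pushforward preimage_bigcup.
apply: measure_semi_sigma_additive.
- by move=> k; exact: mcons.
- apply/trivIsetP => /= i j _ _ ij; rewrite -preimage_setI.
  by move/trivIsetP : tF => /(_ _ _ _ _ ij) ->//; rewrite preimage_set0.
- by rewrite -preimage_bigcup; exact: mcons.
Qed.

HB.instance Definition _ := isMeasure.Build _ _ _ cons_measure
  cons_measure0 cons_measure_ge0 cons_measure_sigma_additive.

Let cons_measure_sigma_finite : sigma_finite setT cons_measure.
Proof.
have [F TF Foo] := sigma_finite_prod (@lebesgue_measure R) mu.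
exists (fun k => @rV_uncons n @^-1` F k).
  by rewrite -preimage_bigcup -TF preimage_setT.
move=> k; have [mF Fk] := Foo k; split.
  by rewrite -[X in measurable X]setTI; exact: measurable_rV_uncons.
rewrite /cons_measure /pushforward -comp_preimage.
by rewrite (_ : _ \o _ = id) //; apply/funext => p /=; rewrite rV_consK.
Qed.

HB.instance Definition _ := Measure_isSigmaFinite.Build _ _ _ cons_measure
  cons_measure_sigma_finite.

End cons_measure.

Fixpoint lebesgue_measure_rV (n : nat) :
    {sigma_finite_measure set 'rV[R]_n -> \bar R} :=
  match n with
  | 0 => dirac (0 : 'rV[R]_0)
  | m.+1 => cons_measure (lebesgue_measure_rV m)
  end.

(* This property characterizes the n-dimensional Lebesgue measure. *)
Lemma lebesgue_measure_rV_box n (A : 'I_n -> set R) :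
  (forall i, measurable (A i)) ->
  lebesgue_measure_rV n [set x | forall i, A i (x ord0 i)] =
  (\prod_(i < n) lebesgue_measure (A i))%E.
Proof.
elim: n A => [|n IHn] A mA /=.
  by rewrite big_ord0 diracE mem_set // => -[].
rewrite /cons_measure /pushforward big_ord_recl.
rewrite -IHn; last by move=> i; exact: mA.
pose B := [set x : 'rV[R]_n | forall i : 'I_n, A (lift ord0 i) (x ord0 i)].
have mB : measurable B.
  rewrite (_ : B = \bigcap_(i in [set: 'I_n])
      ((fun x : 'rV[R]_n => x ord0 i) @^-1` A (lift ord0 i))).
    apply: fin_bigcap_measurable => [|i _]; first exact: finite_finset.
    rewrite -[X in measurable X]setTI.
    exact: measurable_coord.
  by apply/seteqP; split => [x Bx i _|x Bx i]; [exact: Bx|exact: (Bx i)].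
rewrite -[RHS](@product_measure1E _ _ _ _ _ _ _ _ B) //; last exact: mA.
congr (_ _); apply/seteqP; split => -[a x] /=.
  move=> Aax; split => [|i].
    by have := Aax ord0; rewrite mxE unlift_none.
  by have := Aax (lift ord0 i); rewrite mxE liftK.
move=> [Aa Ax] i; rewrite mxE.
by have [j ->|->] := unliftP ord0 i; rewrite ?liftK ?unlift_none.
Qed.

End lebesgue_measure_rV.
Arguments lebesgue_measure_rV : clear implicits.

(* The norm `|x| of the library on 'rV[R]_n is the sup norm. *)
Definition euclidean_norm {R : realType} {n : nat} (x : 'rV[R]_n) : R :=
  Num.sqrt (\sum_(i < n) x ord0 i ^+ 2).

(* Functions on [0, +oo[ are represented by functions on R, of which only the
   values on [0, +oo[ are constrained or used. *)
Definition young_function {R : realType} (g G : R -> R) : Prop :=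
  [/\ {in `[0, +oo[, forall t, g x @[x --> t^'+] --> g t},
      {in `[0, +oo[ &, {homo g : x y / x <= y}},
      g 0 = 0 /\ (forall t, 0 < t -> 0 < g t),
      g x @[x --> +oo] --> +oo &
      forall t, 0 <= t ->
        (G t)%:E = (\int[lebesgue_measure]_(x in `[0%R, t]) (g x)%:E)%E].

Section orlicz.
Context {R : realType} {n : nat}.
Local Notation E := 'rV[R]_n.
Local Notation leb := (lebesgue_measure_rV R n).

(* Measurability with respect to the completion of the Borel sigma-algebra.
   Integrals below are the library's, over Borel sets: for a nonnegative
   integrand they are suprema of integrals of Borel simple functions, so that
   an integrand equal a.e. to a Borel function has the same integral as it. *)
Definition lebesgue_measurable_fun (D : set E) (f : E -> R) : Prop :=
  forall B : set R, measurable B -> completed_algebra_gen leb (D `&` f @^-1` B).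

Definition Linfty (Omega : set E) (f : E -> R) : Prop :=
  lebesgue_measurable_fun Omega f /\
  exists M : R, {ae leb, forall x, Omega x -> `|f x| <= M}.

(* Weak-* convergence in L^oo(Omega) as e -> 0^+ of a family of which only the
   members with e > 0 matter. *)
Definition weak_star_cvg (Omega : set E) (rho : R -> E -> R) (rho0 : E -> R) :=
  [/\ forall e, 0 < e -> Linfty Omega (rho e), Linfty Omega rho0 &
      forall phi : E -> R, leb.-integrable Omega (EFin \o phi) ->
        (\int[leb]_(x in Omega) (rho e x * phi x)%:E)%E @[e --> 0^'+] -->
        (\int[leb]_(x in Omega) (rho0 x * phi x)%:E)%E].

(* D_s u; at x = y the value is 0 / 0 = 0, and the diagonal is negligible. *)
Definition holder_quotient (s : R) (u : E -> R) (x y : E) : R :=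
  (u x - u y) / euclidean_norm (x - y) `^ s.

Definition modular (G : R -> R) (U : set E) (u : E -> R) : \bar R :=
  (\int[leb]_(x in U) (G `|u x|)%:E)%E.

Definition frac_modular (s : R) (G : R -> R) (u : E -> R) : \bar R :=
  (\int[leb \x leb]_z
    (G `|holder_quotient s u z.1 z.2| / euclidean_norm (z.1 - z.2) ^+ n)%:E)%E.

Definition frac_orlicz_sobolev (s : R) (G : R -> R) (U : set E) : set (E -> R) :=
  [set u | [/\ lebesgue_measurable_fun setT u,
               (modular G U u < +oo)%E & (frac_modular s G u < +oo)%E]].

Definition frac_orlicz_sobolev0 (s : R) (G : R -> R) (Omega : set E) :
    set (E -> R) :=
  [set u | frac_orlicz_sobolev s G setT u /\
           {ae leb, forall x, ~ Omega x -> u x = 0}].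

Definition constraint_set (s : R) (G : R -> R) (Omega : set E) (mu : R) :
    set (E -> R) :=
  [set u | frac_orlicz_sobolev0 s G Omega u /\ modular G Omega u = mu%:E].

Definition alpha1 (s : R) (G : R -> R) (Omega : set E) (mu : R)
    (rho : E -> R) : \bar R :=
  ereal_inf [set (frac_modular s G u /
                  \int[leb]_(x in Omega) (rho x * G `|u x|)%:E)%E
            | u in constraint_set s G Omega mu].

End orlicz.

(* Main.v *)
(** The quotient depends on [rho] only through [int rho w] with [w = G(|u|)], so
    it suffices that [int (rho_e - rho_0) w] tends to [0] uniformly over the
    admissible [u] of energy at most [K]; on that set [int rho w] stays in
    [[rhom * mu, rhop * mu]], and the infima converge.

    No compact embedding is needed.  Monotonicity of [g] and [t g(t) <= pp G(t)]
    give, for [|x - y| <= d],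
      [|w x - w y| <= pp d^s (w x + w y + G(|D_s u(x, y)|))],
    and [G(|D_s u|) <= d^n G(|D_s u|) / |x - y|^n].  Cut a box containing [Omega]
    into cubes of side [h], so that [d = sqrt n * h], and let [c_Q] be the mean of
    [w] over the cube [Q].  Summing over the cubes,
      [sum_Q int_Q |w - c_Q| <= pp d^s (2 mu + n^(n/2) K)],
    which is small with [h], uniformly in [u].  For fixed [h], what is left is
    [sum_Q c_Q int_Q (rho_e - rho_0)] with [0 <= c_Q <= mu / h^n]: finitely many
    instances of weak-* convergence. *)

Require Import Defs.
From HB Require Import structures.
From mathcomp Require Import all_boot all_order all_algebra.
From mathcomp Require Import all_classical all_reals all_analysis.
From mathcomp Require Import measurable_realfun.
From mathcomp Require Import ring lra.
Set Implicit Arguments.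
Unset Strict Implicit.
Unset Printing Implicit Defensive.
Import Order.TTheory GRing.Theory Num.Theory.
Import numFieldNormedType.Exports.

Local Open Scope classical_set_scope.
Local Open Scope ring_scope.

(** * Integration up to null sets *)

Section ae_integral.
Context d (T : measurableType d) (R : realType) (mu : {measure set T -> \bar R}).
Local Open Scope ereal_scope.
Import HBNNSimple.

Let ge0_integral_eqNN (N : set T) (f g : T -> \bar R) :
  measurable N -> mu N = 0 -> (forall x, 0 <= f x) -> (forall x, 0 <= g x) ->
  (forall x, ~ N x -> f x = g x) -> \int[mu]_x f x <= \int[mu]_x g x.
Proof.
move=> mN N0 f0 g0 fg; rewrite !ge0_integralTE//.
apply: ge_ereal_sup => _ [h /= hf <-].
have mNC : measurable (~` N) by exact: measurableC.
apply: ereal_sup_ubound; exists (proj_nnsfun h mNC) => /=.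
  move=> x; rewrite -[leLHS]/((h x * \1_(~` N) x)%:E) indicE.
  have [xN|xN] := boolP (x \in ~` N); last by rewrite mulr0.
  by rewrite mulr1 -fg//; apply: set_mem.
rewrite -!integralT_nnsfun; apply: ae_eq_integral => //.
- exact/measurable_EFinP.
- exact/measurable_EFinP.
exists N; split => // x /= /not_implyP[_]; apply: contra_notP => Nx /=.
by rewrite -[LHS]/((h x * \1_(~` N) x)%:E) indicE mem_set// mulr1.
Qed.

(* Unlike [ae_eq_integral], this asks no measurability: for a nonnegative
   integrand the integral is a supremum over simple functions, which may be
   set to [0] on a null set without changing their integral. *)
Lemma ae_eq_integral_nonmeasurable (D : set T) (f g : T -> \bar R) :
  {ae mu, forall x, D x -> f x = g x} ->
  \int[mu]_(x in D) f x = \int[mu]_(x in D) g x.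
Proof.
move=> [N [mN N0 fgN]].
have fg x : ~ N x -> (f \_ D) x = (g \_ D) x.
  move=> Nx; rewrite !patchE; case: ifPn => // xD.
  by apply: contra_notP Nx => fgx; apply: fgN => /= h; apply/fgx/h/set_mem.
rewrite integral_mkcond [RHS]integral_mkcond integralE [RHS]integralE.
congr (_ - _); apply/eqP; rewrite eq_le; apply/andP; split;
  apply: (ge0_integral_eqNN mN N0) => // x /fg;
  by rewrite ?funeposE ?funenegE => ->.
Qed.

End ae_integral.

(** * Borel versions of functions measurable for the completion *)

Section borel_version.
Context d (T : measurableType d) (R : realType) (mu : {measure set T -> \bar R}).

(** A set of the completed algebra is Borel up to a Borel null set. Only the preimages of half-lines
    with rational endpoint have to be corrected; they are countably many, so a single null set [N]
    serves all of them. *)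
Lemma borel_version (D : set T) (f : T -> R) :
  (forall B : set R, measurable B -> completed_algebra_gen mu (D `&` f @^-1` B)) ->
  exists N, [/\ measurable N, mu N = 0%E & measurable_fun setT (f \_ (D `\` N))].
Proof.
move=> mf.
have AN B : measurable B -> exists AN : set T * set T,
  [/\ measurable AN.1, measurable AN.2, mu AN.2 = 0%E &
      D `&` f @^-1` B `\` AN.2 = AN.1 `\` AN.2].
  move=> mB; have [A mA [M [N [mN N0 MN]] AM]] := mf B mB.
  exists (A, N); split => //=; rewrite -AM setDUl.
  by rewrite (_ : M `\` N = set0) ?setU0//; apply/seteqP; split=> // x [/MN].
have [A0N0 [mA0 mN0 muN0 AN0]] := AN setT measurableT.
have /choice[F HF] : forall q : rat, exists AN : set T * set T,
    [/\ measurable AN.1, measurable AN.2, mu AN.2 = 0%E &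
      D `&` f @^-1` `]ratr q, +oo[%classic `\` AN.2 = AN.1 `\` AN.2].
  by move=> q; apply: AN.
have [e eP] : exists e : nat -> option rat, forall q, exists k, e k = Some q.
  by exists unpickle => q; exists (pickle q); rewrite pickleK.
pose G k := if e k is Some q then (F q).2 else set0.
pose N := A0N0.2 `|` \bigcup_k G k.
have mG k : measurable (G k).
  by rewrite /G; case: (e k) => // q; have [] := HF q.
have mN : measurable N by apply: measurableU => //; exact: bigcup_measurable.
have FN q : (F q).2 `<=` N.
  by move=> x Fx; have [k ek] := eP q; right; exists k; rewrite /G ?ek.
have muN : mu N = 0%E.
  apply: measure_negligible => //; apply: negligibleU.
    exact/negligibleP.
  apply: negligible_bigcup => k; apply/negligibleP => //.
  by rewrite /G; case: (e k) => [q|]; rewrite ?measure0//; have [] := HF q.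
(* [D] is the preimage of the whole line, so the pair [A0N0] chosen for [setT] shows that [D] is
   Borel off [N]. *)
have mDN : measurable (D `\` N).
  have -> : D `\` N = A0N0.1 `\` N.
    have N0N : A0N0.2 `<=` N by move=> x ?; left.
    have := AN0; rewrite preimage_setT setIT => AE.
    by rewrite -(setDUK N0N) -!setDDl AE.
  exact: measurableD.
have mFD q : measurable (D `&` f @^-1` `]ratr q, +oo[%classic `\` N).
  have [mA mM _ AE] := HF q.
  by rewrite -(setDUK (FN q)) -!setDDl AE setDDl (setDUK (FN q)); exact: measurableD.
exists N; split => //.
apply: (measurability (@RGenOInfty.G R)); first exact: RGenOInfty.measurableE.
move=> _ [_ [r ->] <-]; rewrite setTI.
(* Outside [D] minus [N] the restriction takes the default value 0, which lies in the half-line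
   exactly when [r < 0]. Inside, a rational fits between [r] and the value. *)
have -> : (f \_ (D `\` N)) @^-1` `]r, +oo[%classic =
    (if r < 0 then ~` (D `\` N) else set0) `|`
    \bigcup_(q in [set q : rat | r < ratr q])
      (D `&` f @^-1` `]ratr q, +oo[%classic `\` N).
  apply/seteqP; split => x /=; rewrite in_itv /= andbT patchE.
    case: ifPn => [/set_mem[Dx Nx] rf|/negP xD r0].
      have [q /itvP qrf] := rat_in_itvoo rf.
      by right; exists q => /=; rewrite ?qrf//; split => //; split => //=; rewrite in_itv/= qrf.
    left; rewrite r0 => DNx; apply: xD; exact: mem_set.
  move=> [|[q /= rq [[Dx fx] Nx]]].
    by case: ifPn => // r0 DNx; rewrite memNset.
  rewrite mem_set//; move: fx; rewrite in_itv/= andbT; exact: lt_trans.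
apply: measurableU; first by case: ifPn => // _; exact: measurableC.
rewrite bigcup_mkcond; apply: countable_bigcupT_measurable => // q.
by case: ifP.
Qed.

End borel_version.

(** * Row vectors *)

Section row_vectors.
Context {R : realType} {n : nat}.
Local Notation E := 'rV[R]_n.
Local Notation leb := (lebesgue_measure_rV R n).

Lemma measurable_box (A : 'I_n -> set R) : (forall i, measurable (A i)) ->
  measurable [set x : E | forall i, A i (x ord0 i)].
Proof.
move=> mA; rewrite (_ : mkset _ = \bigcap_(i in [set: 'I_n])
    ((fun x : E => x ord0 i) @^-1` A i)).
  apply: fin_bigcap_measurable => [|i _]; first exact: finite_finset.
  by rewrite -[X in measurable X]setTI; exact: measurable_coord.
by apply/seteqP; split => [x Bx i _|x Bx i]; [exact: Bx|exact: (Bx i)].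
Qed.

(** Balls of the sup norm are boxes, so each point of [U] lies in a box with rational corners
    contained in [U], and there are countably many of these. *)
Lemma open_measurable_rV (U : set E) : open U -> measurable U.
Proof.
move=> oU.
pose box (ab : {ffun 'I_n -> rat} * {ffun 'I_n -> rat}) : set E :=
  [set x | forall i, `]ratr (ab.1 i), ratr (ab.2 i)[%classic (x ord0 i)].
have -> : U = \bigcup_(ab in [set ab | box ab `<=` U]) box ab.
  apply/seteqP; split => [x Ux|x [ab /= abU /abU]]//.
  have /nbhs_ballP[e /= e0 xeU] : nbhs x U by apply: open_nbhs_nbhs; split.
  have /choice[a Ha] (i : 'I_n) : exists q : rat, x ord0 i - e < ratr q < x ord0 i.
    have [q /itvP qx] := @rat_in_itvoo _ (x ord0 i - e) (x ord0 i) ltac:(lra).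
    by exists q; rewrite !qx.
  have /choice[b Hb] (i : 'I_n) : exists q : rat, x ord0 i < ratr q < x ord0 i + e.
    have [q /itvP qx] := @rat_in_itvoo _ (x ord0 i) (x ord0 i + e) ltac:(lra).
    by exists q; rewrite !qx.
  exists (finfun a, finfun b) => /=.
    move=> y /= aby; apply: xeU; split => //= i j.
    have := aby j; rewrite (ord1 i) /ball /= in_itv/= !ffunE.
    have /andP[? ?] := Ha j; have /andP[? ?] := Hb j => /andP[? ?].
    by rewrite ltr_norml; apply/andP; split; lra.
  move=> i; rewrite /= in_itv/= !ffunE.
  by have /andP[_ ->] := Ha i; have /andP[-> _] := Hb i.
rewrite bigcup_mkcond; apply: countable_bigcupT_measurable => // ab.
by case: ifP => // _; apply: (@measurable_box (fun i => `]ratr (ab.1 i), ratr (ab.2 i)[%classic)) => i.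
Qed.

Lemma euclidean_norm_ge0 (x : E) : 0 <= euclidean_norm x.
Proof. exact: sqrtr_ge0. Qed.

Lemma euclidean_norm_gt0 (x : E) : x != 0 -> 0 < euclidean_norm x.
Proof.
move=> x0; rewrite sqrtr_gt0 lt_def sumr_ge0 ?andbT; last by move=> i _; exact: sqr_ge0.
apply: contra x0 => /eqP/psumr_eq0P H; apply/eqP/rowP => i; rewrite mxE.
by apply/eqP; rewrite -sqrf_eq0 H// => j _; exact: sqr_ge0.
Qed.

Lemma euclidean_norm_le (x : E) (h : R) : 0 <= h ->
  (forall i, `|x ord0 i| <= h) -> euclidean_norm x <= Num.sqrt n%:R * h.
Proof.
move=> h0 xh; rewrite -[h in leRHS]ger0_norm// -sqrtr_sqr -sqrtrM//; apply: ler_wsqrtr.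
rewrite mulr_natl -[n in leRHS]card_ord -sumr_const.
by apply: ler_sum => i _; rewrite -real_normK ?num_real// ler_sqr ?nnegrE.
Qed.

Lemma measurable_euclidean_dist :
  measurable_fun setT (fun z : E * E => euclidean_norm (z.1 - z.2)).
Proof.
rewrite (_ : (fun _ => _) = (fun z : E * E =>
    (\sum_(i < n) (z.1 ord0 i - z.2 ord0 i) ^+ 2) `^ 2^-1)); last first.
  apply/funext => z; rewrite powR12_sqrt ?sumr_ge0// => [|i _]; last exact: sqr_ge0.
  by rewrite /euclidean_norm; under eq_bigr do rewrite !mxE.
apply: (measurableT_comp (measurable_powR 2^-1)).
apply: measurable_sum => i; apply: measurable_funX.
by apply: measurable_funB; apply: (measurableT_comp (measurable_coord i)).
Qed.

End row_vectors.

(** * Young functions *)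

Section young_function_theory.
Context {R : realType} (g G : R -> R).
Hypothesis youngG : young_function g G.

Lemma young_function0 : G 0 = 0.
Proof.
have [_ _ _ _ GE] := youngG; apply/EFin_inj.
by rewrite GE// set_itv1 integral_set1.
Qed.

Let g_ge0 t : 0 <= t -> 0 <= g t.
Proof.
have [_ _ [g0 gt0] _ _] := youngG.
by rewrite le_eqVlt => /predU1P[<-|/gt0/ltW//]; rewrite g0.
Qed.

(** The increment is the integral of [g] over []a, b]], where [0 <= g <= g b]. *)
Lemma young_function_increment a b : 0 <= a -> a <= b ->
  0 <= G b - G a <= g b * (b - a).
Proof.
have [_ ndg _ _ GE] := youngG => a0 ab; have b0 := le_trans a0 ab.
(* [g] is constrained on [[0, +oo[] only; [gm] continues it to the left by [g 0], hence is monotone,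
   and so measurable, on the whole line. *)
pose gm x := g (Num.max x 0).
have gmE x : 0 <= x -> gm x = g x by move=> x0; rewrite /gm max_l.
have gm0 x : 0 <= gm x by rewrite g_ge0// le_max lexx orbT.
have ndgm : nondecreasing_fun gm.
  have max0 (x : R) : Num.max x 0 \in `[0, +oo[ by rewrite in_itv/= andbT le_max lexx orbT.
  by move=> x y xy; apply: ndg => //; rewrite ge_max !le_max xy lexx orbT.
have mgm D : measurable D -> measurable_fun D (EFin \o gm).
  by move=> mD; apply/measurable_EFinP; exact: nondecreasing_measurable.
have GmE t : 0 <= t -> (G t)%:E = (\int[lebesgue_measure]_(x in `[0%R, t]) (gm x)%:E)%E.
  move=> t0; rewrite GE//; apply: eq_integral => x.
  by rewrite inE/= in_itv/= => /andP[x0 _]; rewrite gmE.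
have split_ab : `[0, b]%classic = `[0, a]%classic `|` `]a, b]%classic.
  by apply: itv_bndbnd_setU; rewrite bnd_simp.
have GbE : (G b)%:E = ((G a)%:E + \int[lebesgue_measure]_(x in `]a, b]) (gm x)%:E)%E.
  rewrite GmE// split_ab ge0_integral_setU//=; first by rewrite GmE.
  - by apply: mgm; exact: measurableU.
  - by move=> x _; rewrite lee_fin.
  - apply/disj_setPS => x [/=]; rewrite !in_itv/= => /andP[_ xa] /andP[ax _].
    by move: (lt_le_trans ax xa); rewrite ltxx.
have dE : ((G b - G a)%:E = \int[lebesgue_measure]_(x in `]a, b]) (gm x)%:E)%E.
  by rewrite EFinB GbE [X in (X - _)%E]addeC addeK.
rewrite -!lee_fin dE; apply/andP; split.
  by apply: integral_ge0 => x _; rewrite lee_fin.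
apply: (@le_trans _ _ (\int[lebesgue_measure]_(x in `]a, b]) (cst (g b)%:E x))%E).
  apply: ge0_le_integral => //=.
  - by move=> x _; rewrite lee_fin.
  - exact: mgm.
  - by move=> x; rewrite in_itv/= => /andP[_ xb]; rewrite lee_fin -(gmE b)// ndgm.
rewrite integral_cst//= lebesgue_measure_itv/= lte_fin.
case: ifPn => [_|]; first by rewrite -EFinD -EFinM.
by rewrite -leNgt => ba; rewrite mule0 lee_fin mulr_ge0 ?g_ge0// subr_ge0.
Qed.

Lemma young_function_nondecreasing a b : 0 <= a -> a <= b -> G a <= G b.
Proof. by move=> a0 ab; have /andP[] := young_function_increment a0 ab; rewrite subr_ge0. Qed.

Lemma young_function_ge0 t : 0 <= t -> 0 <= G t.
Proof. by move=> t0; rewrite -young_function0 young_function_nondecreasing. Qed.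

Context (pm pp : R).
Hypothesis pm_gt1 : 1 < pm.
Hypothesis growthG : forall t, 0 < t -> pm <= t * g t / G t <= pp.

Lemma growth_exponent_ge0 : 0 <= pp.
Proof. by have /andP[/le_trans h /h] := growthG ltr01; move: pm_gt1; lra. Qed.

Lemma young_function_growth t : 0 <= t -> t * g t <= pp * G t.
Proof.
rewrite le_eqVlt => /predU1P[<-|t0]; first by rewrite mul0r young_function0 mulr0.
have /andP[pmle lepp] := growthG t0.
have := young_function_ge0 (ltW t0); rewrite le_eqVlt => /predU1P[G0|G0].
  (* If [G t] were 0, the quotient in [pmle] would be 0 by the convention [0^-1 = 0], against
     [1 < pm]. *)
  by move: pmle pm_gt1; rewrite -G0 invr0 mulr0; lra.
by rewrite -ler_pdivrMr.
Qed.

(* With [m = max a b]: the increment of [G] is at most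
   [g m * (D * H) <= (g m * m + g D * D) * H]. *)
Lemma young_function_lipschitz (a b D H : R) : 0 <= a -> 0 <= b -> 0 <= D -> 0 <= H ->
  `|a - b| <= D * H -> `|G a - G b| <= pp * H * (G a + G b + G D).
Proof.
have [_ ndg _ _ _] := youngG.
wlog ba : a b / b <= a => [wl a0 b0 D0 H0|].
  have [/wl|/ltW/wl ab abDH] := leP b a; first exact.
  by rewrite distrC (addrC (G a)); apply: ab => //; rewrite distrC.
move=> a0 b0 D0 H0; rewrite ger0_norm ?subr_ge0// => abDH.
have /andP[d0 dG] := young_function_increment b0 ba; rewrite ger0_norm//.
have Gb0 := young_function_ge0 b0.
apply: (le_trans dG); apply: (@le_trans _ _ (g a * (D * H))).
  by rewrite ler_wpM2l ?g_ge0.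
have gaD : g a * D <= pp * G a + pp * G D.
  have aG := young_function_growth a0; have DG := young_function_growth D0.
  have aga : 0 <= a * g a by rewrite mulr_ge0 ?g_ge0.
  have DgD : 0 <= D * g D by rewrite mulr_ge0 ?g_ge0.
  have [Da|/ltW aD] := leP D a.
    have : g a * D <= g a * a by rewrite ler_wpM2l ?g_ge0.
    by lra.
  have : g a * D <= g D * D by rewrite ler_wpM2r// ndg// in_itv/= andbT.
  by lra.
apply: (@le_trans _ _ ((pp * G a + pp * G D) * H)); first by rewrite mulrA ler_wpM2r.
(* The surplus term in [G b] makes the bound symmetric in [a] and [b], which the reduction to
   [b <= a] relies on. *)
rewrite -subr_ge0 (_ : _ - _ = pp * G b * H); last by ring.
by rewrite !mulr_ge0// growth_exponent_ge0.
Qed.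

End young_function_theory.
Lemma measurable_young_function_norm (R : realType) (g G : R -> R) : young_function g G ->
  measurable_fun setT (fun t : R => G `|t|).
Proof.
move=> youngG; pose Gm (t : R) := G (Num.max t 0).
rewrite (_ : (fun t => _) = Gm \o Num.norm); last first.
  by apply/funext => t; rewrite /Gm/= max_l.
apply: measurableT_comp => //; apply: nondecreasing_measurable => // x y xy.
rewrite /Gm; apply: (young_function_nondecreasing youngG).
  by rewrite le_max lexx orbT.
by rewrite ge_max !le_max xy lexx orbT.
Qed.

(** * Mean oscillation on a partition *)

Lemma bounded_on (T : Type) (R : realType) (A : set T) (f : T -> R) (M : R) :
  (forall x, `|f x| <= M) -> [bounded f x | x in A].
Proof.
move=> fM; exists M; split=> [|N MN x _ /=]; first exact: num_real.
exact: le_trans (ltW MN).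
Qed.

Lemma integrable_cst_fin d (T : measurableType d) (R : realType)
    (m : {measure set T -> \bar R}) (Q : set T) (v : R) (z : R) :
  measurable Q -> m Q = v%:E -> m.-integrable Q (EFin \o cst z).
Proof.
move=> mQ mQv; apply: measurable_bounded_integrable => //; first by rewrite mQv ltry.
exact: (@bounded_on _ _ _ _ `|z|).
Qed.

Section mean_oscillation.
Context d (T : measurableType d) (R : realType).
Variable m : {sigma_finite_measure set T -> \bar R}.
Variable w : T -> R.
Hypotheses (mw : measurable_fun setT w) (w0 : forall x, 0 <= w x).
Hypothesis iw : m.-integrable setT (EFin \o w).

Section on_a_cell.
Variables (Q : set T) (v : R).
Hypotheses (mQ : measurable Q) (v0 : 0 < v) (mQv : (m : {measure set T -> \bar R}) Q = v%:E).

Let c := (\int[m]_(x in Q) w x) / v.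

Let iwQ : m.-integrable Q (EFin \o w).
Proof. exact: integrableS iw. Qed.

Let icst z : m.-integrable Q (EFin \o cst z).
Proof. exact: integrable_cst_fin mQ mQv. Qed.

(** Since [v * (w x - c)] is the integral of [w x - w y] over [y] in [Q], the pointwise bound can be
    integrated in [y], then in [x]. The terms [a * w x] and [a * w y] contribute equally, whence the
    factor 2; Tonelli handles [k]. *)
Lemma integral_mean_oscillation (a : R) (k : T * T -> R) : 0 <= a ->
  measurable_fun setT k -> (forall z, 0 <= k z) ->
  (forall x y, Q x -> Q y -> `|w x - w y| <= a * (w x + w y) + k (x, y)) ->
  (v%:E * \int[m]_(x in Q) `|w x - c|%:E <=
   (2 * a * v)%:E * \int[m]_(x in Q) (w x)%:E + \int[m \x m]_z (k z)%:E)%E.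
Proof.
move=> a0 mk k0 wk.
have mkE : measurable_fun setT (EFin \o k) by exact/measurable_EFinP.
have kE0 z : (0 <= (EFin \o k) z)%E by rewrite /= lee_fin.
have mwQ : measurable_fun Q w by exact: measurable_funS mw.
have mkx x : measurable_fun Q (fun y => k (x, y)).
  by apply: (@measurable_funS _ _ _ _ setT) => //; exact: measurableT_comp.
(* [Fk x] is the integral of [k (x, y)] over all [y]; introducing it through an equation keeps it
   opaque to simplification. *)
have [Fk FkE] : {F | F = fubini_F m (EFin \o k)} by eexists.
have pointwise x : Q x -> ((v * `|w x - c|)%:E <=
    (a * v * w x)%:E + a%:E * \int[m]_(y in Q) (w y)%:E
     + Fk x)%E.
  move=> Qx; have iwx : m.-integrable Q (EFin \o (fun y => w x - w y)).
    have := integrableB mQ (icst (w x)) iwQ.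
    by apply: eq_integrable => // y _; rewrite /= EFinB.
  have -> : v * `|w x - c| = `|\int[m]_(y in Q) (w x - w y)|.
    rewrite (RintegralB mQ (icst (w x)) iwQ) Rintegral_cst// mQv/= -[v in LHS]gtr0_norm// -normrM.
    by congr Num.norm; rewrite mulrBr /c mulrCA divff ?gt_eqF// mulr1 mulrC.
  apply: (@le_trans _ _ (\int[m]_(y in Q) `|w x - w y|%:E)%E).
    rewrite EFin_normr_Rintegral//; apply: le_abse_integral => //.
    exact: measurable_int iwx.
  apply: (@le_trans _ _ (\int[m]_(y in Q)
      ((a * w x)%:E + a%:E * (w y)%:E + (k (x, y))%:E))%E).
    apply: ge0_le_integral => //=.
    - apply/measurable_EFinP; apply: measurableT_comp => //.
      exact: measurable_funB.
    - apply: emeasurable_funD; last exact/measurable_EFinP.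
      apply: emeasurable_funD => //; apply: measurable_funeM.
      exact/measurable_EFinP.
    - by move=> y Qy; rewrite -EFinM -!EFinD lee_fin -mulrDr wk.
  rewrite !ge0_integralD//=; last 7 first.
  - by move=> y _; rewrite lee_fin mulr_ge0.
  - by move=> y _; rewrite -EFinM lee_fin mulr_ge0.
  - by apply: measurable_funeM; exact/measurable_EFinP.
  - by move=> y _; rewrite -EFinM -EFinD lee_fin addr_ge0// mulr_ge0.
  - apply: emeasurable_funD => //; apply: measurable_funeM.
    exact/measurable_EFinP.
  - by move=> y _; rewrite lee_fin.
  - exact/measurable_EFinP.
  rewrite integral_cst// mQv ge0_integralZl//=; last 2 first.
  - exact/measurable_EFinP.
  - by move=> y _; rewrite lee_fin.
  rewrite -EFinM (mulrAC a) leeD2l// FkE; apply: ge0_subset_integral => //.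
  - by apply/measurable_EFinP; exact: measurableT_comp.
  - by move=> y _; rewrite lee_fin.
have mF : measurable_fun setT Fk.
  by rewrite FkE; exact: measurable_fun_fubini_tonelli_F.
have F0 x : (0 <= Fk x)%E by rewrite FkE; exact: integral_ge0.
have iw0 : (0 <= \int[m]_(x in Q) (w x)%:E)%E.
  by apply: integral_ge0 => x _; rewrite lee_fin.
rewrite -ge0_integralZl//; last 2 first.
- apply/measurable_EFinP; apply: measurableT_comp => //.
  exact: measurable_funB.
- by rewrite lee_fin ltW.
apply: (@le_trans _ _ (\int[m]_(x in Q) ((a * v)%:E * (w x)%:E +
    a%:E * \int[m]_(y in Q) (w y)%:E + Fk x))%E).
  apply: ge0_le_integral => //=.
  - by move=> x _; rewrite -EFinM lee_fin mulr_ge0// ltW.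
  - apply: measurable_funeM; apply/measurable_EFinP; apply: measurableT_comp => //.
    exact: measurable_funB.
  - apply: emeasurable_funD; last exact: measurable_funS mF.
    apply: emeasurable_funD => //; apply: measurable_funeM.
    exact/measurable_EFinP.
have av0 : 0 <= a * v by rewrite mulr_ge0// ltW.
rewrite !ge0_integralD//=; last 6 first.
- by move=> y _; rewrite -EFinM lee_fin mulr_ge0.
- by apply: measurable_funeM; exact/measurable_EFinP.
- by move=> y _; rewrite mule_ge0 ?lee_fin.
- by move=> y _; rewrite adde_ge0// mule_ge0 ?lee_fin.
- apply: emeasurable_funD => //; apply: measurable_funeM.
  exact/measurable_EFinP.
- exact: measurable_funS mF.
rewrite integral_cst// mQv ge0_integralZl//=; last 2 first.
- exact/measurable_EFinP.
- by move=> y _; rewrite lee_fin.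
rewrite leeD//.
  rewrite (muleC a%:E) -muleA -EFinM (muleC _ (a * v)%:E) -ge0_muleDl ?lee_fin//.
  by rewrite -EFinD -mulrA mulr2n mulrDl mul1r.
rewrite fubini_tonelli1//.
by rewrite -[fubini_F _ _]FkE; exact: ge0_subset_integral.
Qed.

(** Write [w] as [(w - c) + c] with [c] its mean: the first part is controlled by [C], and the
    second sees [r] only through its integral over [Q]. *)
Lemma norm_Rintegral_mul_le (r : T -> R) (C : R) : measurable_fun setT r ->
  (forall x, `|r x| <= C) ->
  `|\int[m]_(x in Q) (r x * w x)| <= C * (\int[m]_(x in Q) `|w x - c|)
     + (\int[m]_(x in Q) w x) / v * `|\int[m]_(x in Q) r x|.
Proof.
move=> mr rC; have C0 : 0 <= C by apply: le_trans (rC point).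
have rbd : [bounded r x | x in Q] by exact: (@bounded_on _ _ _ _ C).
have mrQ : measurable_fun Q r by exact: measurable_funS mr.
have ir : m.-integrable Q (EFin \o r).
  by apply: measurable_bounded_integrable => //; rewrite mQv ltry.
have iwc : m.-integrable Q (EFin \o (fun x => w x - c)).
  have := integrableB mQ iwQ (icst c).
  by apply: eq_integrable => // y _; rewrite /= EFinB.
have irwc : m.-integrable Q (EFin \o (fun x => r x * (w x - c))).
  have := integrableMr mQ mrQ rbd iwc.
  by apply: eq_integrable => // y _; rewrite /= EFinM.
have icr : m.-integrable Q (EFin \o (fun x => c * r x)).
  by have := integrableZl mQ c ir; apply: eq_integrable.
have -> : \int[m]_(x in Q) (r x * w x) =
    \int[m]_(x in Q) (r x * (w x - c)) + c * \int[m]_(x in Q) r x.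
  by rewrite -RintegralZl// -RintegralD//; apply: eq_Rintegral => x _; ring.
apply: (le_trans (ler_normD _ _)); apply: lerD; last first.
  have c0 : 0 <= c by apply: divr_ge0; [exact: Rintegral_ge0 | exact: ltW].
  by rewrite normrM (ger0_norm c0).
apply: (le_trans (le_normr_Rintegral _ _)) => //.
rewrite -RintegralZl//; last exact: (integrable_norm iwc).
apply: le_Rintegral => //.
- exact: (integrable_norm irwc).
- have := integrableZl mQ C (integrable_norm iwc); exact: eq_integrable.
- by move=> x _; rewrite normrM ler_wpM2r.
Qed.

End on_a_cell.

(** As [r] vanishes off the cells, the integral splits over them, and the two bounds on a cell are
    summed. Every mean of [w] is at most [M / v], with [M] the total integral of [w]. *)
Lemma norm_Rintegral_mul_le_partition (I : finType) (Q : I -> set T) (v : R)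
    (r : T -> R) (C a K : R) (k : T * T -> R) :
  (forall i, measurable (Q i)) -> trivIset setT Q -> 0 < v ->
  (forall i, (m : {measure set T -> \bar R}) (Q i) = v%:E) ->
  measurable_fun setT r -> (forall x, `|r x| <= C) ->
  (forall x, r x != 0 -> exists i, Q i x) -> 0 <= a ->
  measurable_fun setT k -> (forall z, 0 <= k z) ->
  (\int[m \x m]_z (k z)%:E <= K%:E)%E ->
  (forall i x y, Q i x -> Q i y -> `|w x - w y| <= a * (w x + w y) + k (x, y)) ->
  `|\int[m]_x (r x * w x)| <= C * (2 * a * (\int[m]_x w x) + K / v)
    + (\int[m]_x w x) / v * \sum_i `|\int[m]_(x in Q i) r x|.
Proof.
move=> mQ tQ v0 mQv mr rC rQ a0 mk k0 kK wk; set M := \int[m]_x w x.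
have C0 : 0 <= C by apply: le_trans (rC point).
pose D := \big[setU/set0]_(i <- index_enum I) Q i.
have mD : measurable D by exact: bigsetU_measurable.
have tQs : trivIset [set` index_enum I] Q by exact: sub_trivIset tQ.
have irw : m.-integrable setT (EFin \o (fun x => r x * w x)).
  have rbd : [bounded r x | x in setT] by exact: (@bounded_on _ _ _ _ C).
  have := integrableMr measurableT mr rbd iw.
  by apply: eq_integrable => // y _; rewrite /= EFinM.
have -> : \int[m]_x (r x * w x) = \sum_i \int[m]_(x in Q i) (r x * w x).
  rewrite /Rintegral sum_fine => [|i _]; last first.
    by apply: integrable_fin_num => //; exact: integrableS irw.
  rewrite -(@integral_bigsetU_EFin _ _ _ m _ Q (fun x => r x * w x)) ?index_enum_uniq//.
    rewrite [in RHS]integral_mkcond; congr fine; apply: eq_integral => x _.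
    rewrite patchE; case: ifPn => // xD; have [->|rx] := eqVneq (r x) 0.
      by rewrite mul0r.
    have [i Qix] := rQ x rx; move/negP: xD; case; apply/mem_set.
    by rewrite -bigcup_seq; exists i => //=; rewrite mem_index_enum.
  by apply: measurable_funS (measurable_int _ irw).
have iwQ i : m.-integrable (Q i) (EFin \o w) by exact: integrableS iw.
pose W i := \int[m]_(x in Q i) w x.
have W0 i : 0 <= W i by exact: Rintegral_ge0.
have wE0 (A : set T) x : A x -> (0 <= (EFin \o w) x)%E by rewrite /= lee_fin.
have sumW : \sum_i W i <= M.
  rewrite /W /M /Rintegral sum_fine => [|i _]; last exact: integrable_fin_num.
  rewrite -ge0_integral_bigsetU ?index_enum_uniq//; last 2 first.
  - by apply: measurable_funS (measurable_int _ iw).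
  - exact: wE0.
  apply: fine_le; [| exact: integrable_fin_num|].
    by apply: integrable_fin_num => //; exact: integrableS iw.
  by apply: ge0_subset_integral => //; [exact: measurable_int iw | exact: wE0].
have WM i : W i <= M.
  by apply: le_trans sumW; rewrite (bigD1 i)//= lerDl sumr_ge0.
(* On each cell the oscillation bound is used with [k] cut off to the diagonal block of that cell.
   The blocks are disjoint, so the integrals of the pieces add up to at most [K], whatever the
   number of cells. *)
pose k_ i := k \_ (Q i `*` Q i).
pose K_ i := fine (\int[m \x m]_z (k_ i z)%:E).
have mkE A : measurable A -> measurable_fun A (EFin \o k).
  by move=> mA; apply/measurable_EFinP; exact: measurable_funS mk.
have mQQ i : measurable (Q i `*` Q i) by exact: measurableX.
have k_E i : (\int[m \x m]_z (k_ i z)%:E = \int[m \x m]_(z in Q i `*` Q i) (k z)%:E)%E.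
  rewrite [RHS]integral_mkcond; apply: eq_integral => z _.
  by rewrite /k_ !patchE; case: ifP.
have kE0 (A : set (T * T)) z : A z -> (0 <= (EFin \o k) z)%E by rewrite /= lee_fin.
have sum_k : (\sum_i \int[m \x m]_z (k_ i z)%:E <= K%:E)%E.
  under eq_bigr do rewrite k_E.
  rewrite -(@ge0_integral_bigsetU _ _ _ (m \x m)%E _ (fun i => Q i `*` Q i))
    ?index_enum_uniq//; last 3 first.
  - apply/trivIsetP => i j _ _ ij; apply/seteqP; split => // z [[/= Qi _] [Qj _]].
    by move/trivIsetP : tQ => /(_ i j Logic.I Logic.I ij)/seteqP[+ _] => /(_ z.1); exact.
  - by apply: mkE; exact: bigsetU_measurable.
  - exact: kE0.
  apply: le_trans kK; apply: ge0_subset_integral => //.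
  - exact: bigsetU_measurable.
  - exact: mkE.
  - exact: kE0.
have k_fin i : (\int[m \x m]_z (k_ i z)%:E)%E \is a fin_num.
  rewrite ge0_fin_numE; last by rewrite k_E; apply: integral_ge0 => z /kE0.
  apply: le_lt_trans (ltry K); apply: le_trans sum_k.
  rewrite (bigD1 i)//= leeDl// sume_ge0// => j _.
  by rewrite k_E; apply: integral_ge0 => z /kE0.
pose A i := \int[m]_(x in Q i) `|w x - W i / v|.
have AWK i : A i <= 2 * a * W i + K_ i / v.
  have iA : m.-integrable (Q i) (EFin \o (fun x => w x - W i / v)).
    have := integrableB (mQ i) (iwQ i) (integrable_cst_fin (W i / v) (mQ i) (mQv i)).
    by apply: eq_integrable => // y _; rewrite /= EFinB.
  (* Multiplying by [v] clears the division and gives the form of [integral_mean_oscillation]. *)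
  rewrite -(ler_pM2l v0) mulrDr mulrCA (mulrC v (_ / v)) divfK ?gt_eqF//.
  rewrite mulrA -lee_fin EFinM EFinD EFinM fineK//; last first.
    exact: integrable_fin_num (integrable_norm iA).
  rewrite fineK; last exact: integrable_fin_num (iwQ i).
  rewrite fineK//.
  apply: integral_mean_oscillation => //.
  - apply/(measurable_restrictT _ (mQQ i)); exact: measurable_funS mk.
  - by move=> z; rewrite /k_ patchE; case: ifP.
  - move=> x y Qx Qy; rewrite /k_ patchE mem_set//; exact: wk Qx Qy.
have sumK : \sum_i K_ i <= K.
  by rewrite -lee_fin EFin_sum_fine.
apply: (le_trans (ler_norm_sum _ _ _)).
apply: (@le_trans _ _ (\sum_i (C * (2 * a * W i + K_ i / v) +
    M / v * `|\int[m]_(x in Q i) r x|))).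
  apply: ler_sum => i _.
  apply: (le_trans (norm_Rintegral_mul_le (mQ i) v0 (mQv i) mr rC)).
  apply: lerD; first by rewrite ler_wpM2l ?AWK.
  by rewrite ler_wpM2r// ler_wpM2r ?WM// invr_ge0 ltW.
rewrite big_split/= -!mulr_sumr lerD2r ler_wpM2l// big_split/= -mulr_sumr -mulr_suml.
by rewrite lerD ?ler_wpM2l ?ler_wpM2r ?mulr_ge0 ?invr_ge0 ?(ltW v0).
Qed.

End mean_oscillation.

(** * Cubes and the fractional energy *)

Section cube_grid.
Context {R : realType} {n : nat}.
Local Notation E := 'rV[R]_n.
Local Notation leb := (lebesgue_measure_rV R n).

(** The sides are half-open so that the cubes of one grid are disjoint and still fill the half-open
    box of side [N * h] with lowest corner [(a, ..., a)]. *)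
Definition cube (a h : R) {N : nat} (k : {ffun 'I_n -> 'I_N}) : set E :=
  [set x | forall i, `[a + (k i)%:R * h, a + (k i)%:R * h + h[%classic (x ord0 i)].

Variables (a h : R).
Hypothesis h0 : 0 < h.

Lemma measurable_cube N (k : {ffun 'I_n -> 'I_N}) : measurable (cube a h k).
Proof.
exact: (@measurable_box _ _
  (fun i => `[a + (k i)%:R * h, a + (k i)%:R * h + h[%classic)).
Qed.

Lemma lebesgue_measure_cube N (k : {ffun 'I_n -> 'I_N}) :
  (leb : {measure set E -> \bar R}) (cube a h k) = (h ^+ n)%:E.
Proof.
transitivity (\prod_(i < n)
    lebesgue_measure (`[a + (k i)%:R * h, a + (k i)%:R * h + h[%classic)%R)%E.
  exact: (@lebesgue_measure_rV_box _ _
    (fun i => `[a + (k i)%:R * h, a + (k i)%:R * h + h[%classic)).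
rewrite (eq_bigr (fun=> h%:E)) => [|i _]; last first.
  rewrite lebesgue_measure_itv/= lte_fin ltrDl h0 -EFinB.
  by rewrite addrAC subrr add0r.
by rewrite prodEFin prodr_const card_ord.
Qed.

Lemma trivIset_cube N : trivIset setT (@cube a h N).
Proof.
apply/trivIsetP => k l _ _ kl; apply/seteqP; split => // x [xk xl].
move/eqP : kl; apply; apply/ffunP => i; apply/val_inj/eqP => /=.
have := xk i; have := xl i; rewrite /= !in_itv/= => /andP[al lh] /andP[ak kh].
have lt_succ (p q : nat) : p%:R * h < q%:R * h + h -> (p <= q)%N.
  by rewrite -[X in _ + X]mul1r -mulrDl ltr_pM2r// natr1 ltr_nat ltnS.
by rewrite eqn_leq; apply/andP; split; apply: lt_succ; lra.
Qed.

Lemma cube_cover N (x : E) : (forall i, a <= x ord0 i < a + N%:R * h) ->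
  exists k : {ffun 'I_n -> 'I_N}, cube a h k x.
Proof.
move=> xN; pose p i := Num.truncn ((x ord0 i - a) / h).
have pP i : (p i)%:R * h <= x ord0 i - a < (p i)%:R * h + h.
  have /andP[ax xh] := xN i.
  have : 0 <= (x ord0 i - a) / h by apply: divr_ge0; [rewrite subr_ge0 | exact: ltW].
  move=> /truncn_itv; rewrite -/(p i) ler_pdivlMr// ltr_pdivrMr//.
  by rewrite -natr1 mulrDl mul1r.
have pN i : (p i < N)%N.
  have /andP[px _] := pP i; have /andP[_ xh] := xN i.
  by rewrite -(ltr_nat R) -(ltr_pM2r h0); lra.
exists [ffun i => Ordinal (pN i)] => i /=; rewrite ffunE/= in_itv/=.
by have /andP[? ?] := pP i; apply/andP; split; lra.
Qed.

Lemma cube_dist N (k : {ffun 'I_n -> 'I_N}) (x y : E) : cube a h k x -> cube a h k y ->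
  euclidean_norm (x - y) <= Num.sqrt n%:R * h.
Proof.
move=> xk yk; apply: euclidean_norm_le => [|i]; first exact: ltW.
have := xk i; have := yk i; rewrite /= !in_itv/= !mxE => /andP[? ?] /andP[? ?].
by rewrite ler_norml; apply/andP; split; lra.
Qed.

End cube_grid.

Lemma bounded_set_coord (R : realType) (n : nat) (A : set 'rV[R]_n) : bounded_set A ->
  exists2 L, 0 < L & forall x, A x -> forall i, `|x ord0 i| < L.
Proof.
(* [AM] bounds the norm by any number above [M], such as [|M| + 1]; the second unit makes the
   inequality strict. *)
move=> [M [_ AM]]; exists (`|M| + 2) => [|x Ax i]; first by rewrite ltr_wpDl.
have xM : `|x| <= `|M| + 1 by apply: AM => //; rewrite (le_lt_trans (ler_norm M))// ltrDl.
apply: (@le_lt_trans _ _ (`|M| + 1)); last by rewrite ltrD2l ltr1n.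
apply: le_trans xM; rewrite /Num.norm/= mx_normrE.
exact: (@le_bigmax _ _ _ 0 (fun ij : 'I_1 * 'I_n => `|x ij.1 ij.2|) (ord0, i)).
Qed.

Lemma exists_small_scale (R : realType) (s A c e : R) : 0 < s -> 0 <= A -> 0 <= c -> 0 < e ->
  exists N : nat, (0 < N)%N /\ A * (c / N%:R) `^ s <= e.
Proof.
(* [y] is chosen so that [A * y ^ s = A * e / (A + 1) <= e]; the shift to [A + 1] allows [A = 0].
   Then [N] only has to exceed [c / y]. *)
move=> s0 A0 c0 e0; pose y := (e / (A + 1)) `^ s^-1.
have A1 : 0 < A + 1 by rewrite ltr_wpDl.
have y0 : 0 < y by apply: powR_gt0; exact: divr_gt0.
exists (Num.Def.archi_bound (c / y)).+1; split => //.
set N := _.+1; have N0 : 0 < N%:R :> R by rewrite ltr0n.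
have cNy : c / N%:R <= y.
  rewrite ler_pdivrMr// mulrC -ler_pdivrMr// ltW//.
  apply: (lt_le_trans (archi_boundP _)); first by rewrite divr_ge0// ltW.
  by rewrite ler_nat.
apply: (@le_trans _ _ (A * (e / (A + 1)))).
  rewrite ler_wpM2l//; have -> : e / (A + 1) = y `^ s.
    by rewrite -powRrM mulVf ?gt_eqF// powRr1// divr_ge0 ?ltW.
  by rewrite ge0_ler_powR ?nnegrE ?divr_ge0 ?(ltW s0) ?(ltW y0) ?(ltW N0).
by rewrite mulrCA ler_piMr ?(ltW e0)// ler_pdivrMr// mul1r lerDl.
Qed.

(** * The kernel of the energy and the estimate uniform in the competitor *)

Section uniform_estimate.
Context {R : realType} {n : nat}.
Local Notation E := 'rV[R]_n.
Local Notation leb := (lebesgue_measure_rV R n).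
Variables (s : R) (g G : R -> R) (pm pp : R).
Hypotheses (s0 : 0 < s) (youngG : young_function g G).
Hypotheses (pm_gt1 : 1 < pm) (growthG : forall t, 0 < t -> pm <= t * g t / G t <= pp).

Definition frac_kernel (v : E -> R) (z : E * E) : R :=
  G `|holder_quotient s v z.1 z.2| / euclidean_norm (z.1 - z.2) ^+ n.

Lemma frac_kernel_ge0 v z : 0 <= frac_kernel v z.
Proof.
by rewrite divr_ge0 ?exprn_ge0 ?euclidean_norm_ge0// (young_function_ge0 youngG).
Qed.

Lemma measurable_frac_kernel v : measurable_fun setT v ->
  measurable_fun setT (frac_kernel v).
Proof.
move=> mv.
(* Divisions become products with powers of negative exponent, to which [measurable_powR]
   applies. *)
rewrite (_ : frac_kernel v = (fun z => G `|(v z.1 - v z.2) *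
    euclidean_norm (z.1 - z.2) `^ (- s)| * euclidean_norm (z.1 - z.2) `^ (- n%:R))).
  apply: measurable_funM; last first.
    exact: (measurableT_comp (measurable_powR _) measurable_euclidean_dist).
  apply: (measurableT_comp (measurable_young_function_norm youngG)).
  apply: measurable_funM.
    by apply: measurable_funB; apply: (measurableT_comp mv).
  exact: (measurableT_comp (measurable_powR _) measurable_euclidean_dist).
apply/funext => z.
by rewrite /frac_kernel /holder_quotient !powRN powR_mulrn// euclidean_norm_ge0.
Qed.

Lemma frac_kernel_oscillation v (x y : E) (d : R) : euclidean_norm (x - y) <= d ->
  `|G `|v x| - G `|v y| | <=
  pp * d `^ s * (G `|v x| + G `|v y|) + pp * d `^ s * d ^+ n * frac_kernel v (x, y).
Proof.
move=> xyd; have d0 := le_trans (euclidean_norm_ge0 (x - y)) xyd.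
have H0 : 0 <= d `^ s by exact: powR_ge0.
have pp0 := growth_exponent_ge0 pm_gt1 growthG.
have G0 (t : R) : 0 <= G `|t| by rewrite (young_function_ge0 youngG).
(* On the diagonal the norm is 0 and the divisions below do not cancel, but the left side vanishes
   there. *)
have [<-|xy] := eqVneq x y.
  rewrite subrr normr0; apply: addr_ge0; first by rewrite !mulr_ge0// addr_ge0.
  by apply: mulr_ge0 (frac_kernel_ge0 _ _); rewrite !mulr_ge0// exprn_ge0.
have e0 : 0 < euclidean_norm (x - y) by rewrite euclidean_norm_gt0// subr_eq0.
set D := `|holder_quotient s v x y|.
have := @young_function_lipschitz _ _ _ youngG _ _ pm_gt1 growthG
  `|v x| `|v y| D (d `^ s) (normr_ge0 _) (normr_ge0 _) (normr_ge0 _) H0.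
have h : `| `|v x| - `|v y| | <= D * d `^ s.
  apply: (le_trans (ler_dist_dist _ _)).
  have -> : v x - v y = holder_quotient s v x y * euclidean_norm (x - y) `^ s.
    by rewrite /holder_quotient divfK// gt_eqF// powR_gt0.
  rewrite normrM ler_wpM2l// ger0_norm ?powR_ge0//.
  by rewrite ge0_ler_powR ?nnegrE// ltW.
move=> /(_ h)/le_trans; apply; rewrite mulrDr lerD2l -[leRHS]mulrA ler_wpM2l ?mulr_ge0//.
rewrite /frac_kernel/= -/D mulrCA ler_peMr ?(G0 _ : 0 <= G D)// ler_pdivlMr ?exprn_gt0// mul1r.
by rewrite lerXn2r ?nnegrE// ltW.
Qed.

(** The order of the quantifiers is the point: the cubes and [B] are fixed before [r] and [v]. For
    [r] a difference of two weights, smallness of finitely many integrals of [r] then serves all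
    competitors [v] of energy at most [K] at once. *)
Lemma uniform_weak_estimate (Omega : set E) (mu K C e : R) : bounded_set Omega ->
  0 <= mu -> 0 <= K -> 0 <= C -> 0 < e ->
  exists (N : nat) (Q : {ffun 'I_n -> 'I_N} -> set E) (B : R),
  [/\ forall k, measurable (Q k),
      forall k, ((leb : {measure set E -> \bar R}) (Q k) < +oo)%E,
      0 <= B &
      forall r v : E -> R, measurable_fun setT r -> (forall x, `|r x| <= C) ->
      (forall x, ~ Omega x -> r x = 0) -> measurable_fun setT v ->
      modular G setT v = mu%:E -> (frac_modular s G v <= K%:E)%E ->
      `|\int[leb]_x (r x * G `|v x|)| <= e + B * \sum_k `|\int[leb]_(x in Q k) r x|].
Proof.
move=> /bounded_set_coord[L L0 OL] mu0 K0 C0 e0.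
have pp0 := growth_exponent_ge0 pm_gt1 growthG.
(* With [d] the diameter bound of a cube, the first term of the partition estimate equals
   [A * d ^ s]: the factor [d ^ n] of the kernel term cancels the division by [h ^ n] up to
   [sqrt n ^ n]. *)
pose A := C * (pp * (2 * mu + Num.sqrt n%:R ^+ n * K)).
have A0 : 0 <= A by rewrite !mulr_ge0// addr_ge0 ?mulr_ge0// exprn_ge0 ?sqrtr_ge0.
have [|N [N0 AN]] := @exists_small_scale R s A (Num.sqrt n%:R * (2 * L)) e s0 A0 _ e0.
  by rewrite !mulr_ge0 ?sqrtr_ge0 ?(ltW L0).
(* The box [[-L, L[ ^ n] contains [Omega] and is cut into [N ^ n] cubes of side [h]. *)
pose h := 2 * L / N%:R; have h0 : 0 < h by rewrite !divr_gt0 ?mulr_gt0 ?ltr0n.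
have v0 : 0 < h ^+ n by rewrite exprn_gt0.
exists N, (cube (- L) h), (mu / h ^+ n); split.
- exact: measurable_cube.
- by move=> k; rewrite (lebesgue_measure_cube _ h0) ltry.
- by rewrite divr_ge0// ltW.
move=> r v mr rC rO mv vmu vK.
pose w x := G `|v x|.
have w0 x : 0 <= w x by rewrite (young_function_ge0 youngG).
have mw : measurable_fun setT w.
  exact: (measurableT_comp (measurable_young_function_norm youngG)).
have iw : leb.-integrable setT (EFin \o w).
  apply/integrableP; split; first exact/measurable_EFinP.
  rewrite (eq_integral (EFin \o w)) => [|x _]; last by rewrite /= ger0_norm.
  by rewrite [X in (X < _)%E]vmu ltry.
pose d := Num.sqrt n%:R * h.
have d0 : 0 <= d by rewrite mulr_ge0 ?sqrtr_ge0 ?(ltW h0).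
pose b := pp * d `^ s * d ^+ n.
have b0 : 0 <= b by rewrite !mulr_ge0 ?powR_ge0 ?exprn_ge0.
have kerE : (\int[leb \x leb]_z (b * frac_kernel v z)%:E <= (b * K)%:E)%E.
  under eq_integral do rewrite EFinM.
  rewrite ge0_integralZl//; last 2 first.
  - by apply/measurable_EFinP; exact: measurable_frac_kernel.
  - by move=> z _; rewrite lee_fin frac_kernel_ge0.
  by rewrite (EFinM b); apply: lee_wpmul2l => //; rewrite lee_fin.
have := @norm_Rintegral_mul_le_partition _ _ _ leb w mw w0 iw _ (@cube R n (- L) h N) (h ^+ n)
  r C (pp * d `^ s) (b * K) (fun z => b * frac_kernel v z)
  (@measurable_cube R n (- L) h N) (@trivIset_cube R n (- L) h h0 N) v0
  (@lebesgue_measure_cube R n (- L) h h0 N)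
  mr rC _ _ _ _ kerE _.
have -> : \int[leb]_x w x = mu by rewrite /Rintegral [X in fine X]vmu.
move=> H; apply: (le_trans (H _ _ _ _ _)).
- move=> x rx0; have Ox : Omega x by apply: contrapT => /rO; exact/eqP.
  apply: cube_cover => // i; rewrite mulrC divfK ?pnatr_eq0 -?lt0n//.
  by have := OL x Ox i; rewrite ltr_norml => /andP[? ?]; apply/andP; split; lra.
- by rewrite mulr_ge0 ?powR_ge0.
- by apply: measurable_funM => //; exact: measurable_frac_kernel.
- by move=> z; apply: mulr_ge0 (frac_kernel_ge0 _ _).
- by move=> k x y xk yk; apply: frac_kernel_oscillation; exact: cube_dist xk yk.
rewrite lerD2r; apply: le_trans AN.
have -> : Num.sqrt n%:R * (2 * L) / N%:R = d by rewrite /d /h !mulrA.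
have dn : d ^+ n = Num.sqrt n%:R ^+ n * h ^+ n by rewrite /d exprMn.
rewrite /A /b dn; set hn := h ^+ n in v0 *; set c := d `^ s; set q := _ ^+ n.
rewrite (_ : pp * c * (q * hn) * K / hn = pp * c * q * K); last by field; rewrite gt_eqF.
by rewrite le_eqVlt; apply/orP; left; apply/eqP; ring.
Qed.

End uniform_estimate.

(** * Convergence of the infima *)

Section borel_representatives.
Context {R : realType} {n : nat}.
Local Notation E := 'rV[R]_n.
Local Notation leb := (lebesgue_measure_rV R n).
Variable Omega : set E.
Hypothesis mO : measurable Omega.

(** Setting [f] to 0 also on the null set where the essential bound fails turns it into a bound at
    every point. *)
Lemma borel_representative_Linfty (f : E -> R) (M : R) :
  lebesgue_measurable_fun Omega f -> 0 <= M ->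
  {ae leb, forall x, Omega x -> `|f x| <= M} ->
  exists r : E -> R, [/\ measurable_fun setT r, forall x, `|r x| <= M,
    forall x, ~ Omega x -> r x = 0 & {ae leb, forall x, Omega x -> f x = r x}].
Proof.
move=> /borel_version[N [mN N0 mf]] M0 [N' [mN' N'0 fN']].
exists ((f \_ (Omega `\` N)) \_ (~` N')); split.
- by apply/(measurable_restrictT _ (measurableC mN')); exact: measurable_funS mf.
- move=> x; rewrite patchE; case: ifPn => [/set_mem N'x|_]; last by rewrite normr0.
  rewrite patchE; case: ifPn => [/set_mem[Ox _]|_]; last by rewrite normr0.
  by apply: contra_notP N'x => fM; apply: fN' => /= /(_ Ox).
- move=> x Ox; rewrite patchE; case: ifP => // _; rewrite patchE; case: ifPn => //.
  by move=> /set_mem[].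
- exists (N `|` N'); split; first exact: measurableU.
    apply: measure_negligible; first exact: measurableU.
    by apply: negligibleU; exact/negligibleP.
  move=> x /= /not_implyP[Ox]; apply: contra_notP => /not_orP[Nx N'x].
  by rewrite !patchE !mem_set.
Qed.

Lemma borel_representative_zero_outside (u : E -> R) : lebesgue_measurable_fun setT u ->
  {ae leb, forall x, ~ Omega x -> u x = 0} ->
  exists v : E -> R, [/\ measurable_fun setT v,
    forall x, ~ Omega x -> v x = 0 & {ae leb, forall x, u x = v x}].
Proof.
move=> /borel_version[N [mN N0 mu]] [N' [mN' N'0 uN']].
exists ((u \_ (setT `\` N)) \_ Omega); split.
- by apply/(measurable_restrictT _ mO); exact: measurable_funS mu.
- by move=> x Ox; rewrite patchE memNset.
- exists (N `|` N'); split; first exact: measurableU.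
    apply: measure_negligible; first exact: measurableU.
    by apply: negligibleU; exact/negligibleP.
  move=> x /=; apply: contra_notP => /not_orP[Nx N'x].
  have [Ox|Ox] := pselect (Omega x); first by rewrite !patchE !mem_set.
  rewrite patchE memNset//; apply: contrapT => ux; apply: N'x; apply: uN' => /=.
  by move=> /(_ Ox).
Qed.

Lemma eq_modular (G : R -> R) (U : set E) (u v : E -> R) :
  {ae leb, forall x, u x = v x} -> modular G U u = modular G U v.
Proof.
by move=> uv; apply: ae_eq_integral_nonmeasurable; apply: filterS uv => x ->.
Qed.

(** Changing [u] on a null set [N] affects the integrand only where one of the two coordinates lies
    in [N], and these two strips are null for the product measure. *)
Lemma eq_frac_modular (s : R) (G : R -> R) (u v : E -> R) :
  {ae leb, forall x, u x = v x} -> frac_modular s G u = frac_modular s G v.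
Proof.
move=> [N [mN N0 uvN]]; apply: ae_eq_integral_nonmeasurable.
exists (N `*` setT `|` setT `*` N).
have mNT : measurable (N `*` [set: E]) by exact: measurableX.
have mTN : measurable ([set: E] `*` N) by exact: measurableX.
have NT0 : (leb \x leb)%E (N `*` [set: E]) = 0%E.
  by rewrite product_measure1E// [X in (X * _)%E]N0 mul0e.
have TN0 : (leb \x leb)%E ([set: E] `*` N) = 0%E.
  by rewrite product_measure1E// [X in (_ * X)%E]N0 mule0.
split; first exact: measurableU.
  apply: measure_negligible; first exact: measurableU.
  by apply: negligibleU; apply/negligibleP.
move=> [x y] /= ; apply: contra_notP => /not_orP[Nx Ny] _.
have uv z : ~ N z -> u z = v z by apply: contra_notP => uvz; apply: uvN.
rewrite /holder_quotient /= (uv x) ?(uv y)//.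
- by move=> Nx'; apply: Ny.
- by move=> Nx'; apply: Nx.
Qed.

(** Replaces completion-measurable data on [Omega] by representatives on the whole space; the domain
    can be enlarged because [v] vanishes outside [Omega] and [G 0 = 0]. *)
Lemma weighted_modular_representative (f r : E -> R) (G : R -> R) (u v : E -> R) :
  G 0 = 0 ->
  {ae leb, forall x, Omega x -> f x = r x} -> {ae leb, forall x, u x = v x} ->
  (forall x, ~ Omega x -> v x = 0) ->
  (\int[leb]_(x in Omega) (f x * G `|u x|)%:E = \int[leb]_x (r x * G `|v x|)%:E)%E.
Proof.
move=> G0 fr uv vO.
transitivity (\int[leb]_(x in Omega) (r x * G `|v x|)%:E)%E.
  apply: ae_eq_integral_nonmeasurable; apply: filterS2 fr uv => x fr -> Ox.
  by rewrite fr.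
rewrite integral_mkcond; apply: eq_integral => x _; rewrite patchE.
case: ifPn => // /negP Ox; rewrite vO ?normr0 ?G0 ?mulr0//.
by move=> Ox'; apply: Ox; exact: mem_set.
Qed.

End borel_representatives.

Lemma cvg_sum_norm0 (R : realType) (T : Type) (F : set_system T) (I : Type) (s : seq I)
    (f : I -> T -> R) : Filter F -> (forall i, f i x @[x --> F] --> 0) ->
  \sum_(i <- s) `|f i x| @[x --> F] --> 0.
Proof.
move=> FF f0; elim: s => [|i s IH].
  by under eq_fun do rewrite big_nil; exact: cvg_cst.
under eq_fun do rewrite big_cons.
have := cvgD (cvg_norm (f0 i)) IH; rewrite normr0 addr0; exact.
Qed.

(** Comparing [b] with [a] where [a <= A] suffices: a point with [a x > A] does no better than [x0],
    for which [b x0 <= A + e]. *)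
Lemma ereal_inf_le_add (R : realType) (T : Type) (X : set T) (a b : T -> R) (x0 : T)
    (A e : R) : X x0 -> a x0 <= A -> (forall x, X x -> a x <= A -> b x <= a x + e) ->
  (ereal_inf [set (b x)%:E | x in X] <= ereal_inf [set (a x)%:E | x in X] + e%:E)%E.
Proof.
move=> X0 aA ab; rewrite -leeBlDr//; apply: le_ereal_inf_tmp => _ [x Xx <-].
rewrite leeBlDr//; have [ax|/ltW ax] := leP (a x) A.
  apply: (@le_trans _ _ (b x)%:E); first by apply: ereal_inf_lbound; exists x.
  by rewrite -EFinD lee_fin ab.
apply: (@le_trans _ _ (b x0)%:E); first by apply: ereal_inf_lbound; exists x0.
by rewrite -EFinD lee_fin (le_trans (ab _ X0 aA))// lerD2r (le_trans aA).
Qed.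

(** * Passing to the limit in the weight *)

Section weighted_eigenvalue.
Context {R : realType} {n : nat}.
Local Notation E := 'rV[R]_n.
Local Notation leb := (lebesgue_measure_rV R n).
Variables (Omega : set E) (s mu : R) (g G : R -> R) (pm pp : R).
Hypotheses (openO : open Omega) (boundedO : bounded_set Omega).
Hypotheses (s0 : 0 < s) (mu_gt0 : 0 < mu) (youngG : young_function g G).
Hypotheses (pm_gt1 : 1 < pm) (growthG : forall t, 0 < t -> pm <= t * g t / G t <= pp).
Variables (rho : R -> E -> R) (rho0 : E -> R) (rhom rhop : R).
Hypotheses (rhom_gt0 : 0 < rhom)
  (rho_bnd : forall e, 0 < e -> forall x, rhom <= rho e x <= rhop)
  (rho_cvg : weak_star_cvg Omega rho rho0).

Let mO : measurable Omega. Proof. exact: open_measurable_rV. Qed.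

Let rhop_gt0 : 0 < rhop.
Proof.
by have /andP[/(lt_le_trans rhom_gt0) /lt_le_trans] := rho_bnd ltr01 0; exact.
Qed.

Let constraint_representative u : constraint_set s G Omega mu u ->
  exists v : E -> R, [/\ measurable_fun setT v, forall x, ~ Omega x -> v x = 0,
    {ae leb, forall x, u x = v x}, modular G setT v = mu%:E &
    frac_modular s G v = frac_modular s G u].
Proof.
move=> [[[mu_u _ _] uO] umu].
have [v [mv vO uv]] := borel_representative_zero_outside mO mu_u uO.
exists v; split => //; last by apply/esym; exact: eq_frac_modular.
rewrite -umu (eq_modular _ _ uv) /modular [RHS]integral_mkcond.
apply: eq_integral => x _; rewrite patchE; case: ifPn => // /negP Ox.
rewrite vO ?normr0 ?(young_function0 youngG)// => Ox'.
by apply: Ox; exact: mem_set.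
Qed.

Let integrable_weighted (r v : E -> R) (C : R) : measurable_fun setT r ->
  (forall x, `|r x| <= C) -> measurable_fun setT v -> modular G setT v = mu%:E ->
  leb.-integrable setT (EFin \o (fun x => r x * G `|v x|)).
Proof.
move=> mr rC mv vmu; pose w x := G `|v x|.
have mw : measurable_fun setT w.
  exact: (measurableT_comp (measurable_young_function_norm youngG)).
have iw : leb.-integrable setT (EFin \o w).
  apply/integrableP; split; first exact/measurable_EFinP.
  rewrite (eq_integral (EFin \o w)) => [|x _]; last first.
    by rewrite /= ger0_norm// (young_function_ge0 youngG).
  by rewrite [X in (X < _)%E]vmu ltry.
have := integrableMr measurableT mr (@bounded_on _ _ setT _ _ rC) iw.
by apply: eq_integrable => // y _; rewrite /= EFinM.
Qed.

Let rho_representative : exists (r : R -> E -> R) (r0 : E -> R) (M0 : R),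
  [/\ forall e, 0 < e -> [/\ measurable_fun setT (r e), forall x, `|r e x| <= rhop,
        forall x, ~ Omega x -> r e x = 0 &
        {ae leb, forall x, Omega x -> rho e x = r e x}],
      0 <= M0, measurable_fun setT r0, forall x, `|r0 x| <= M0 &
      (forall x, ~ Omega x -> r0 x = 0) /\
      {ae leb, forall x, Omega x -> rho0 x = r0 x}].
Proof.
have [rhoL [mrho0 [M rho0M]] _] := rho_cvg.
(* The choice ranges over all real [e]; for [e <= 0] the zero function is a dummy. *)
have /choice[r Hr] e : exists r : E -> R, 0 < e ->
    [/\ measurable_fun setT r, forall x, `|r x| <= rhop,
        forall x, ~ Omega x -> r x = 0 &
        {ae leb, forall x, Omega x -> rho e x = r x}].
  have [e0|] := ltP 0 e; last by exists (cst 0).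
  have [|r Hr] := @borel_representative_Linfty _ _ Omega (rho e) rhop
    (rhoL e e0).1 (ltW rhop_gt0).
    apply: aeW => x _; have /andP[rhox ?] := rho_bnd e0 x.
    by rewrite ger0_norm// (le_trans (ltW rhom_gt0)).
  by exists r.
have [r0 [mr0 r0M r0O rho0r0]] := @borel_representative_Linfty _ _ Omega rho0 `|M|
  mrho0 (normr_ge0 _) (filterS (fun x h Ox => le_trans (h Ox) (ler_norm M)) rho0M).
by exists r, r0, `|M|; split.
Qed.

(** The denominator of the quotient as a real number; [weighted_modularE] shows that [fine] loses
    nothing for the weights and competitors considered. *)
Let J (f : E -> R) (u : E -> R) := fine (\int[leb]_(x in Omega) (f x * G `|u x|)%:E)%E.

(** The test function is the indicator of [Q], integrable because [Q] has finite measure. The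
    representatives vanish outside [Omega], so the tested integrals are integrals over all of
    [Q]. *)
Let test_cvg (Q : set E) (r : R -> E -> R) (r0 : E -> R) (M0 : R) :
  measurable Q -> ((leb : {measure set E -> \bar R}) Q < +oo)%E ->
  (forall e, 0 < e -> [/\ measurable_fun setT (r e), forall x, `|r e x| <= rhop,
        forall x, ~ Omega x -> r e x = 0 &
        {ae leb, forall x, Omega x -> rho e x = r e x}]) ->
  measurable_fun setT r0 -> (forall x, `|r0 x| <= M0) ->
  (forall x, ~ Omega x -> r0 x = 0) ->
  {ae leb, forall x, Omega x -> rho0 x = r0 x} ->
  \int[leb]_(x in Q) (r e x - r0 x) @[e --> 0^'+] --> 0.
Proof.
move=> mQ Qoo Hr mr0 r0M r0O rho0r0; have [_ _ cvg_rho] := rho_cvg.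
have ir (f : E -> R) (C : R) : measurable_fun setT f -> (forall x, `|f x| <= C) ->
    leb.-integrable Q (EFin \o f).
  move=> mf fC; apply: measurable_bounded_integrable => //.
    exact: measurable_funS mf.
  exact: bounded_on fC.
pose phi := (cst 1 : E -> R) \_ Q.
have iphi : leb.-integrable Omega (EFin \o phi).
  apply: (@integrableS _ _ _ _ setT) => //.
  rewrite /phi -restrict_EFin.
  apply/(integrable_mkcond (EFin \o (cst 1 : E -> R)) mQ).
  by apply: (@ir _ 1) => // x; rewrite normr1.
have phiE (f h : E -> R) : {ae leb, forall x, Omega x -> f x = h x} ->
    (forall x, ~ Omega x -> h x = 0) ->
    (\int[leb]_(x in Omega) (f x * phi x)%:E = \int[leb]_(x in Q) (h x)%:E)%E.
  move=> fh hO; transitivity (\int[leb]_(x in Omega) (h x * phi x)%:E)%E.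
    by apply: ae_eq_integral_nonmeasurable; apply: filterS fh => x fh Ox; rewrite fh.
  rewrite integral_mkcond [RHS]integral_mkcond; apply: eq_integral => x _.
  rewrite !patchE /phi patchE; case: ifPn => [_|/negP Ox].
    by case: ifP => _; rewrite ?mulr1 ?mulr0.
  by rewrite hO ?if_same// => Ox'; apply: Ox; exact: mem_set.
have := cvg_rho phi iphi; rewrite (phiE _ r0)// => H.
have {}H : (\int[leb]_(x in Omega) (rho e x * phi x)%:E)%E @[e --> 0^'+] -->
    (\int[leb]_(x in Q) r0 x)%:E.
  by rewrite /Rintegral fineK//; apply: integrable_fin_num (ir _ _ mr0 r0M).
have {}H : fine (\int[leb]_(x in Omega) (rho e x * phi x)%:E)%E @[e --> 0^'+] -->
    \int[leb]_(x in Q) r0 x.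
  by apply: fine_cvg; exact: H.
have {}H : fine (\int[leb]_(x in Omega) (rho e x * phi x)%:E)%E
    - \int[leb]_(x in Q) r0 x @[e --> 0^'+] -->
    \int[leb]_(x in Q) r0 x - \int[leb]_(x in Q) r0 x.
  by apply: cvgB => //; exact: cvg_cst.
rewrite subrr in H; apply: cvg_trans H; apply: near_eq_cvg.
near=> e; have e0 : 0 < e by near: e; exact: nbhs_right_gt.
have [mre reM reO rho_re] := Hr e e0.
rewrite RintegralB//; last 2 first.
- exact: ir reM.
- exact: ir r0M.
by rewrite /= (phiE _ (r e)).
Unshelve. all: by end_near. Qed.

Let uniform_cvg (K d : R) : 0 <= K -> 0 < d ->
  \forall e \near 0^'+, forall u, constraint_set s G Omega mu u ->
    (frac_modular s G u <= K%:E)%E -> `|J (rho e) u - J rho0 u| <= d.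
Proof.
move=> K0 d0; have G0 := young_function0 youngG.
have [r [r0 [M0 [Hr M00 mr0 r0M [r0O rho0r0]]]]] := rho_representative.
have d20 : 0 < d / 2 by rewrite divr_gt0.
have [N [Q [B [mQ Qoo B0 HQ]]]] := @uniform_weak_estimate _ _ s _ _ _ _ s0 youngG pm_gt1
  growthG Omega mu K (rhop + M0) (d / 2) boundedO (ltW mu_gt0) K0
  (addr_ge0 (ltW rhop_gt0) M00) d20.
(* One half of [d] is spent on the uniform estimate. The other bounds [B] times the sum over the
   cubes, made smaller than [d / 2 / (B + 1)]; here [B] may be 0. *)
have B1 : 0 < B + 1 by rewrite ltr_wpDl.
have Hsum : \sum_k `|\int[leb]_(x in Q k) (r e x - r0 x)| @[e --> 0^'+] --> 0.
  by apply: cvg_sum_norm0 => k; exact: test_cvg Hr mr0 r0M r0O rho0r0.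
have {}Hsum : \forall e \near 0^'+,
    `|0 - \sum_k `|\int[leb]_(x in Q k) (r e x - r0 x)| | <= d / 2 / (B + 1).
  by move/cvgrPdist_le : Hsum; apply; exact: divr_gt0.
near=> e; have e0 : 0 < e by near: e; exact: nbhs_right_gt.
have [mre reM reO rho_re] := Hr e e0.
move=> u /constraint_representative[v [mv vO uv vmu vu]] uK.
rewrite /J (weighted_modular_representative G0 rho_re uv vO).
rewrite (weighted_modular_representative G0 rho0r0 uv vO).
rewrite -[X in X - _]/(\int[leb]_x (r e x * G `|v x|)).
rewrite -[X in _ - X]/(\int[leb]_x (r0 x * G `|v x|)).
rewrite -RintegralB//; [|exact: integrable_weighted reM mv vmu
                        |exact: integrable_weighted r0M mv vmu].
under eq_Rintegral do rewrite -mulrBl.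
apply: (le_trans (HQ (fun x => r e x - r0 x) v _ _ _ _ _ _)) => //.
- exact: measurable_funB.
- by move=> x; apply: (le_trans (ler_normB _ _)); rewrite lerD.
- by move=> x Ox; rewrite reO// r0O// subrr.
- by rewrite vu.
rewrite [leRHS](splitr d) lerD2l.
have : `|0 - \sum_k `|\int[leb]_(x in Q k) (r e x - r0 x)| | <= d / 2 / (B + 1).
  by near: e.
rewrite sub0r normrN ger0_norm ?sumr_ge0// ler_pdivlMr// => /(le_trans _); apply.
by rewrite mulrC ler_wpM2l ?sumr_ge0// lerDl.
Unshelve. all: by end_near. Qed.

Let weighted_modularE (f u : E -> R) : f = rho0 \/ (exists2 e, 0 < e & f = rho e) ->
  constraint_set s G Omega mu u ->
  (\int[leb]_(x in Omega) (f x * G `|u x|)%:E)%E = (J f u)%:E.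
Proof.
move=> frho /constraint_representative[v [mv vO uv vmu vu]].
have G0 := young_function0 youngG.
have [r [r0 [M0 [Hr M00 mr0 r0M [r0O rho0r0]]]]] := rho_representative.
rewrite /J; case: frho => [->|[e e0 ->]].
  rewrite (weighted_modular_representative G0 rho0r0 uv vO) fineK//.
  exact: integrable_fin_num (integrable_weighted mr0 r0M mv vmu).
have [mre reM reO rho_re] := Hr e e0.
rewrite (weighted_modular_representative G0 rho_re uv vO) fineK//.
exact: integrable_fin_num (integrable_weighted mre reM mv vmu).
Qed.

Let frac_modularE u : constraint_set s G Omega mu u ->
  exists2 c, 0 <= c & frac_modular s G u = c%:E.
Proof.
move=> [[[_ _ uoo] _] _]; have u0 : (0 <= frac_modular s G u)%E.
  by apply: integral_ge0 => z _; rewrite lee_fin; exact: (frac_kernel_ge0 s youngG).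
exists (fine (frac_modular s G u)); first exact: fine_ge0.
by rewrite fineK// ge0_fin_numE.
Qed.

Let J_bounds e u : 0 < e -> constraint_set s G Omega mu u ->
  rhom * mu <= J (rho e) u <= rhop * mu.
Proof.
move=> e0 cu; rewrite -!lee_fin -weighted_modularE//; last by right; exists e.
have [v [mv vO uv vmu vu]] := constraint_representative cu.
have G0 := young_function0 youngG.
have [r [r0 [M0 [Hr _ _ _ _]]]] := rho_representative.
have [mr rM rO rho_r] := Hr e e0.
(* [r e] is nonnegative only almost everywhere. Its absolute value is still a representative, and
   makes the integrand nonnegative at every point, as [ae_ge0_le_integral] asks. *)
have rho_r' : {ae leb, forall x, Omega x -> rho e x = `|r e x|}.
  apply: filterS rho_r => x rx Ox; rewrite -rx// ger0_norm//.
  by have /andP[+ _] := rho_bnd e0 x; apply: le_trans; exact: ltW.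
rewrite (@weighted_modular_representative _ _ _ _ (fun x => `|r e x|) _ _ _ G0 rho_r' uv vO).
have w0 x : 0 <= G `|v x| by rewrite (young_function_ge0 youngG).
have mw : measurable_fun setT (fun x => G `|v x|).
  exact: (measurableT_comp (measurable_young_function_norm youngG)).
have cE c : 0 <= c -> ((c * mu)%:E = \int[leb]_x (c * G `|v x|)%:E)%E.
  move=> c0; under eq_integral do rewrite EFinM.
  rewrite ge0_integralZl//; first by rewrite EFinM -vmu.
  - exact/measurable_EFinP.
  - by move=> x _; rewrite lee_fin.
have r_bnd : {ae leb, forall x, rhom * G `|v x| <= `|r e x| * G `|v x| <= rhop * G `|v x|}.
  apply: filterS rho_r' => x rx; have [Ox|Ox] := pselect (Omega x).
    by rewrite -rx//; have /andP[? ?] := rho_bnd e0 x; rewrite !ler_wpM2r.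
  by rewrite vO// normr0 G0 !mulr0 lexx.
have mrw : measurable_fun setT (fun x => (`|r e x| * G `|v x|)%:E).
  by apply/measurable_EFinP; apply: measurable_funM => //; exact: measurableT_comp.
have mcw c : measurable_fun setT (fun x => (c * G `|v x|)%:E).
  by apply/measurable_EFinP; exact: measurable_funM.
rewrite (cE rhom (ltW rhom_gt0)) (cE rhop (ltW rhop_gt0)).
apply/andP; split; apply: ae_ge0_le_integral => //.
- by move=> x _; rewrite lee_fin mulr_ge0// ltW.
- by move=> x _; rewrite lee_fin mulr_ge0.
- by apply: filterS r_bnd => x /andP[+ _] _; rewrite lee_fin.
- by move=> x _; rewrite lee_fin mulr_ge0.
- by move=> x _; rewrite lee_fin mulr_ge0// ltW.
- by apply: filterS r_bnd => x /andP[_ +] _; rewrite lee_fin.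
Qed.

(** The pointwise bounds are given for [rho e] with [e > 0]; those on [J rho0 u] come from
    [J_bounds] in the limit, using [uniform_cvg] with the energy of [u] itself as [K]. *)
Let J0_bounds u : constraint_set s G Omega mu u -> rhom * mu <= J rho0 u <= rhop * mu.
Proof.
move=> cu; have [c c0 uc] := frac_modularE cu.
have H d : 0 < d -> exists2 e, 0 < e & `|J (rho e) u - J rho0 u| <= d.
  move=> d0; have : \forall e \near 0^'+, 0 < e /\ `|J (rho e) u - J rho0 u| <= d.
    near=> e; split; first by near: e; exact: nbhs_right_gt.
    have : forall u, constraint_set s G Omega mu u ->
        (frac_modular s G u <= c%:E)%E -> `|J (rho e) u - J rho0 u| <= d.
      by near: e; exact: uniform_cvg.
    by apply; rewrite ?uc.
  by move=> /filter_ex[e [e0 ed]]; exists e.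
apply/andP; split; apply/ler_addgt0Pr => d /H[e e0].
  by have /andP[? ?] := J_bounds e0 cu; rewrite ler_norml => /andP[? ?]; lra.
by have /andP[? ?] := J_bounds e0 cu; rewrite ler_norml => /andP[? ?]; lra.
Unshelve. all: by end_near. Qed.

Lemma alpha1_weak_star_continuous :
  alpha1 s G Omega mu (rho e) @[e --> 0^'+] --> alpha1 s G Omega mu rho0.
Proof.
set M := constraint_set s G Omega mu.
(* Without competitors every infimum is [+oo], and the limit is that of a constant. *)
have [M0|/set0P[u0 Mu0]] := eqVneq M set0.
  have alphaE f : alpha1 s G Omega mu f = +oo%E.
    by rewrite /alpha1 -/M M0 image_set0 ereal_inf0.
  by rewrite alphaE; under eq_fun do rewrite alphaE; exact: cvg_cst.
pose phi (u : E -> R) := fine (frac_modular s G u).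
have phiE u : M u -> frac_modular s G u = (phi u)%:E.
  by move=> /frac_modularE[c _ uc]; rewrite /phi uc.
have phi0 u : M u -> 0 <= phi u by move=> /frac_modularE[c c0 uc]; rewrite /phi uc.
have m0 : 0 < rhom * mu by rewrite mulr_gt0.
have alphaE f : f = rho0 \/ (exists2 e, 0 < e & f = rho e) ->
    (forall u, M u -> rhom * mu <= J f u) ->
    alpha1 s G Omega mu f = ereal_inf [set (phi u / J f u)%:E | u in M].
  move=> frho Jf; rewrite /alpha1; congr ereal_inf; apply: eq_imagel => u Mu.
  rewrite weighted_modularE// phiE// inver gt_eqF ?EFinM//.
  exact: lt_le_trans (Jf u Mu).
(* [A] bounds the quotient at [u0] for all weights involved, since denominators are at least
   [rhom * mu]. A competitor with quotient at most [A] has energy at most [K], as denominators are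
   at most [rhop * mu]. *)
pose A := phi u0 / (rhom * mu).
pose K := A * (rhop * mu).
have A0 : 0 <= A by rewrite divr_ge0 ?phi0 ?ltW.
have K0 : 0 <= K by apply: mulr_ge0 => //; apply: mulr_ge0; exact: ltW.
have K1 : 0 < K + 1 by rewrite ltr_wpDl.
(* One-sided comparison, applied later in both directions. The quotients differ by
   [phi u * (a u - b u) / (a u * b u)], at most [K * d / (rhom * mu) ^ 2]; the choice of [d] makes
   this at most [e], with [K + 1] in place of [K] to avoid dividing by 0. *)
have close (a b : (E -> R) -> R) (e d : R) : 0 < e -> d = e * (rhom * mu) ^+ 2 / (K + 1) ->
    (forall u, M u -> rhom * mu <= a u <= rhop * mu) ->
    (forall u, M u -> rhom * mu <= b u <= rhop * mu) ->
    (forall u, M u -> (frac_modular s G u <= K%:E)%E -> `|a u - b u| <= d) ->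
  (ereal_inf [set (phi u / b u)%:E | u in M] <=
   ereal_inf [set (phi u / a u)%:E | u in M] + e%:E)%E.
  move=> e0 dE aM bM ab; apply: (@ereal_inf_le_add _ _ _ _ _ u0 A) => //.
    have /andP[ma _] := aM _ Mu0; rewrite ler_wpM2l ?phi0// lef_pV2 ?posrE//.
    exact: lt_le_trans ma.
  move=> u Mu uA; have /andP[ma aM'] := aM u Mu; have /andP[mb _] := bM u Mu.
  have a0 := lt_le_trans m0 ma; have b0 := lt_le_trans m0 mb.
  have uK : phi u <= K.
    move: uA; rewrite ler_pdivrMr// => /le_trans; apply.
    by rewrite ler_wpM2l.
  have := ab u Mu; rewrite phiE// lee_fin => /(_ uK).
  rewrite -lerBlDl => abd.
  have d0 : 0 <= d by apply: le_trans abd.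
  have -> : phi u / b u - phi u / a u = phi u * (a u - b u) / (a u * b u).
    by field; rewrite !gt_eqF.
  rewrite ler_pdivrMr ?mulr_gt0//.
  apply: (@le_trans _ _ (K * d)).
    apply: (le_trans (ler_wpM2l (phi0 u Mu) (le_trans (ler_norm _) abd))).
    by rewrite ler_wpM2r.
  apply: (@le_trans _ _ (e * (rhom * mu) ^+ 2)).
    rewrite dE mulrCA; apply: ler_piMr; last by rewrite ler_pdivrMr// mul1r lerDl.
    by apply: mulr_ge0; [exact: ltW | rewrite exprn_ge0 ?ltW].
  by rewrite ler_wpM2l ?(ltW e0)// expr2 ler_pM// ltW.
have J0B u : M u -> rhom * mu <= J rho0 u by move=> /J0_bounds/andP[].
have JB e u : 0 < e -> M u -> rhom * mu <= J (rho e) u.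
  by move=> e0 /(J_bounds e0)/andP[].
have alpha_fin f : f = rho0 \/ (exists2 e, 0 < e & f = rho e) ->
    (forall u, M u -> rhom * mu <= J f u) -> alpha1 s G Omega mu f \is a fin_num.
  move=> frho Jf; rewrite alphaE// ge0_fin_numE.
    by apply: le_lt_trans (ltry (phi u0 / J f u0)); apply: ereal_inf_lbound; exists u0.
  apply: le_ereal_inf_tmp => _ [u Mu <-]; rewrite lee_fin divr_ge0 ?phi0//.
  by rewrite (le_trans _ (Jf u Mu))// ltW.
have fin0 := alpha_fin rho0 (or_introl erefl) J0B.
have fin_e e : 0 < e -> alpha1 s G Omega mu (rho e) \is a fin_num.
  by move=> e0; apply: alpha_fin; [right; exists e | move=> u; exact: JB].
rewrite -(fineK fin0); apply/fine_cvgP; split.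
  by near=> e; apply: fin_e; near: e; exact: nbhs_right_gt.
apply/cvgrPdist_le => eps eps0.
pose d := eps * (rhom * mu) ^+ 2 / (K + 1).
have d0 : 0 < d by rewrite !mulr_gt0 ?exprn_gt0 ?invr_gt0// ltr_wpDl.
near=> e; have e0 : 0 < e by near: e; exact: nbhs_right_gt.
have Jd : forall u, M u -> (frac_modular s G u <= K%:E)%E -> `|J (rho e) u - J rho0 u| <= d.
  by near: e; exact: uniform_cvg.
(* The [eq_ind] term is [Jd] with the two values exchanged by [distrC]. *)
have := close (J rho0) (J (rho e)) eps d eps0 erefl J0_bounds (fun u => J_bounds e0)
  (fun u Mu uK => eq_ind _ (fun x => x <= d) (Jd u Mu uK) _ (distrC _ _)).
have := close (J (rho e)) (J rho0) eps d eps0 erefl (fun u => J_bounds e0) J0_bounds Jd.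
rewrite -!alphaE//; [|by right; exists e|by move=> u; exact: JB|by left].
rewrite /= -[X in (X <= _ + _)%E](fineK fin0) -[X in (_ <= X + _)%E](fineK (fin_e e e0)).
rewrite -EFinD lee_fin => le1.
rewrite -[X in (X <= _ + _)%E](fineK (fin_e e e0)) -[X in (_ <= X + _)%E](fineK fin0).
rewrite -EFinD lee_fin => le2.
by rewrite ler_norml; apply/andP; split; lra.
Unshelve. all: by end_near. Qed.

End weighted_eigenvalue.

Theorem theorem5p4 (R : realType) (n : nat) (n_gt0 : (0 < n)%N)
    (Omega : set 'rV[R]_n) (openO : open Omega) (boundedO : bounded_set Omega)
    (s : R) (s_gt0 : 0 < s) (s_lt1 : s < 1)
    (mu : R) (mu_gt0 : 0 < mu)
    (g G : R -> R) (youngG : young_function g G)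
    (pm pp : R) (pm_gt1 : 1 < pm)
    (growthG : forall t, 0 < t -> pm <= t * g t / G t <= pp)
    (rho : R -> 'rV[R]_n -> R) (rho0 : 'rV[R]_n -> R)
    (rhom rhop : R) (rhom_gt0 : 0 < rhom)
    (rho_bnd : forall e, 0 < e -> forall x, rhom <= rho e x <= rhop)
    (rho_cvg : weak_star_cvg Omega rho rho0) :
  alpha1 s G Omega mu (rho e) @[e --> 0^'+] --> alpha1 s G Omega mu rho0.
Proof.
exact: (alpha1_weak_star_continuous openO boundedO s_gt0 mu_gt0 youngG pm_gt1
  growthG rhom_gt0 rho_bnd rho_cvg).
Qed.
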